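(* Let $H>0$, $0<h_0<H$, $c_1>1$, $\Omega=(0,1)\times(0,H)$, $\Omega_0=(0,1)\times(0,h_0)$, $\Omega_1=(0,1)\times(h_0,H)$, let $c=1$ on $\Omega_0$ and $c=c_1$ on $\Omega_1$, and let $A=-c\Delta$ with Dirichlet boundary conditions. Let $\omega=\omega_1\times(a,b)\subset\Omega$ be open and let $(v_{k,\ell})_k$ be a sequence of guided eigenfunctions with the index $\ell\ge1$ fixed. Case 1: if $\omega\subset\Omega_1$, i.e. $h_0\le a<b$, then $$a_1\lambda_{k,\ell}^{-3/2}e^{-a_2\lambda_{k,\ell}^{1/2}}\|v_{k,\ell}\|^2_{L^2(\Omega)}\sim_{k\to\infty}\|v_{k,\ell}\|^2_{L^2(\omega)},$$ where $a_1=\frac{\mathrm{vol}(\omega_1)(\ell\pi)^2}{h_0^3}\big(\frac{c_1}{c_1-1}\big)^{3/2}$ and $a_2=2(a-h_0)\sqrt{\frac{c_1-1}{c_1}}$. Case 2: if $\omega\subset\Omega_0$, i.e. $0\le a<b<h_0$, then $$\frac{\|v_{k,\ell}\|^2_{L^2(\omega)}}{\|v_{k,\ell}\|^2_{L^2(\Omega)}}\sim_{k\to\infty}\frac{1}{h_0}\mathrm{vol}(\omega)\left(1-\frac{\sin(\ell\frac{\pi}{h_0}(b-a))}{\ell\frac{\pi}{h_0}(b-a)}\cos\!\big(\ell\tfrac{\pi}{h_0}(a+b)\big)\right).$$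
   Context: $A=-c\Delta$ acts in $L^2(\Omega,c^{-1}dx)$ with domain $H^1_0(\Omega)\cap H^2(\Omega)$. For each integer $k\ge1$, $\lambda_{k,1}<\lambda_{k,2}<\cdots$ are the numbers $\lambda$ for which there is a nonzero $u_{k,\ell}\in H^2(0,H)$ with $u''+(\frac{\lambda}{c}-k^2\pi^2)u=0$, $u(0)=u(H)=0$; the eigenfunctions are $v_{k,\ell}(x)=a_{k,\ell}\sqrt2\sin(k\pi x_1)u_{k,\ell}(x_2)$, $a_{k,\ell}\neq0$ a normalizing constant. The eigenfunction $v_{k,\ell}$ is called guided if $k^2\pi^2<\lambda_{k,\ell}<c_1k^2\pi^2$; for fixed $\ell$ this holds for all large $k$. Here $\omega_1\subset(0,1)$ is nonempty and open, and $\mathrm{vol}$ is Lebesgue measure. *)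

(* Defs.v *)
From HB Require Import structures.
From mathcomp Require Import all_boot all_order all_algebra.
From mathcomp Require Import all_classical all_reals all_analysis.
Set Implicit Arguments.
Unset Strict Implicit.
Unset Printing Implicit Defensive.
Import Order.TTheory GRing.Theory Num.Theory.
Import numFieldNormedType.Exports.
Local Open Scope classical_set_scope.
Local Open Scope ring_scope.

Definition leb1 (R : realType) : {measure set (measurableTypeR R) -> \bar R} :=
  [the {measure set _ -> \bar R} of @lebesgue_measure R].

Definition leb2 (R : realType) :
    {measure set (measurableTypeR R * measurableTypeR R) -> \bar R} :=
  [the {measure set _ -> \bar R} of
     (@lebesgue_measure R \x @lebesgue_measure R)%E].

Definition L2 (R : realType) d (T : measurableType d)
    (m : {measure set T -> \bar R}) (D : set T) (f : T -> R) : Prop :=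
  measurable_fun D f /\ m.-integrable D (fun x => (f x ^+ 2)%:E).

Definition sqnorm (R : realType) d (T : measurableType d)
    (m : {measure set T -> \bar R}) (D : set T) (f : T -> R) : R :=
  \int[m]_(x in D) (f x ^+ 2).

(* Weak derivatives are tested against C^1 functions with compact support;
   by mollification this gives the same Sobolev spaces as C^oo test
   functions. *)

Section OneDimensional.
Context {R : realType}.
Implicit Types (I : set R) (u g phi : R -> R).

Definition test1 I phi : Prop :=
  [/\ forall x, derivable phi x 1,
      continuous (derive1 phi) &
      exists K : set R,
        [/\ compact K, K `<=` I & forall x, ~ K x -> phi x = 0]].

Definition weak_derivative1 I u g : Prop :=
  forall phi, test1 I phi ->
    \int[leb1 R]_(x in I) (u x * derive1 phi x) =
    - \int[leb1 R]_(x in I) (g x * phi x).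

(* [u] is in H^2(I), with weak derivatives [u'] and [u'']. *)
Definition H2_interval I u (u' u'' : R -> R) : Prop :=
  [/\ L2 (leb1 R) I u, L2 (leb1 R) I u', L2 (leb1 R) I u'',
      weak_derivative1 I u u' & weak_derivative1 I u' u''].

End OneDimensional.

Section TwoDimensional.
Context {R : realType}.
Implicit Types (U : set (R * R)) (v g phi : R * R -> R) (e : R * R).

Definition e1 : R * R := (1, 0).
Definition e2 : R * R := (0, 1).

Definition test2 U phi : Prop :=
  [/\ forall z, derivable phi z e1 /\ derivable phi z e2,
      continuous ('D_e1 phi), continuous ('D_e2 phi) &
      exists K : set (R * R),
        [/\ compact K, K `<=` U & forall z, ~ K z -> phi z = 0]].

Definition weak_derivative2 U e v g : Prop :=
  forall phi, test2 U phi ->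
    \int[leb2 R]_(z in U) (v z * 'D_e phi z) =
    - \int[leb2 R]_(z in U) (g z * phi z).

(* [v] is in H^1(U), with weak gradient [(g1, g2)]. *)
Definition H1_domain U v g1 g2 : Prop :=
  [/\ L2 (leb2 R) U v, L2 (leb2 R) U g1, L2 (leb2 R) U g2,
      weak_derivative2 U e1 v g1 & weak_derivative2 U e2 v g2].

(* [v], with weak gradient [(g1, g2)], is an H^1(U)-limit of test functions. *)
Definition H10_domain U v g1 g2 : Prop :=
  H1_domain U v g1 g2 /\
  exists phi : nat -> R * R -> R,
    [/\ forall n, test2 U (phi n),
        sqnorm (leb2 R) U (fun z => phi n z - v z) @[n --> \oo] --> (0 : R),
        sqnorm (leb2 R) U (fun z => 'D_e1 (phi n) z - g1 z) @[n --> \oo]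
          --> (0 : R) &
        sqnorm (leb2 R) U (fun z => 'D_e2 (phi n) z - g2 z) @[n --> \oo]
          --> (0 : R)].

(* [v] is an eigenfunction, with eigenvalue [lambda], of [- c Delta] on the
   domain H^1_0(U) /\ H^2(U). *)
Definition dirichlet_eigenfunction U (c : R * R -> R) (lambda : R) v : Prop :=
  ~ (\forall z \ae leb2 R, U z -> v z = 0) /\
  exists g1 g2 g11 g12 g21 g22 : R * R -> R,
    [/\ H10_domain U v g1 g2, H1_domain U g1 g11 g12,
        H1_domain U g2 g21 g22 &
        \forall z \ae leb2 R, U z -> - c z * (g11 z + g22 z) = lambda * v z].

End TwoDimensional.

Section Layers.
Context {R : realType}.
Variables (H h0 c1 : R).

Definition Omega : set (R * R) := `]0, 1[ `*` `]0, H[.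
Definition Omega0 : set (R * R) := `]0, 1[ `*` `]0, h0[.
Definition Omega1 : set (R * R) := `]0, 1[ `*` `]h0, H[.

(* [c] as a function of the second coordinate; its value on the interface,
   a null set, is immaterial. *)
Definition layer_c (x2 : R) : R := if x2 < h0 then 1 else c1.

(* [u] stands for the continuous representative on [0, H] of its class in
   H^2(0, H), so that the boundary values make sense pointwise. *)
Definition transverse_mode (k : nat) (lambda : R) (u : R -> R) : Prop :=
  [/\ {within `[0, H], continuous u},
      exists u' u'' : R -> R, H2_interval `]0, H[ u u' u'' /\
        (\forall x \ae leb1 R, `]0, H[%classic x ->
           u'' x + (lambda / layer_c x - (k%:R * pi) ^+ 2) * u x = 0),
      u 0 = 0, u H = 0 &
      exists2 x, `]0, H[%classic x & u x <> 0].

(* [lam k 1 < lam k 2 < ...] lists the numbers admitting a transverse mode. *)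
Definition transverse_spectrum (lam : nat -> nat -> R) : Prop :=
  forall k : nat, (0 < k)%N ->
    (forall l m : nat, (0 < l)%N -> (l < m)%N -> lam k l < lam k m) /\
    [set lam k l | l in [set l : nat | (0 < l)%N]] =
    [set lambda | exists u, transverse_mode k lambda u].

Definition separated_eigenfunction (lam : nat -> nat -> R) (k l : nat)
    (v : R * R -> R) : Prop :=
  dirichlet_eigenfunction Omega (fun z => layer_c z.2) (lam k l) v /\
  exists (a : R) (u : R -> R),
    [/\ a <> 0, transverse_mode k (lam k l) u &
        forall z, Omega z ->
          v z = a * Num.sqrt 2 * sin (k%:R * pi * z.1) * u z.2].

Definition guided (lam : nat -> nat -> R) (k l : nat) : Prop :=
  (k%:R * pi) ^+ 2 < lam k l < c1 * (k%:R * pi) ^+ 2.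

End Layers.

(* Main.v *)
Require Import Defs.
From HB Require Import structures.
From mathcomp Require Import all_boot all_order all_algebra.
From mathcomp Require Import all_classical all_reals all_analysis.
From mathcomp Require Import measurable_realfun ring lra.
Set Implicit Arguments.
Unset Strict Implicit.
Unset Printing Implicit Defensive.
Import Order.TTheory GRing.Theory Num.Theory.
Import numFieldNormedType.Exports.
Local Open Scope classical_set_scope.
Local Open Scope ring_scope.

(** Separation of variables makes the problem one-dimensional.  Put
    mu^2 = lambda - k^2 pi^2 and kappa^2 = k^2 pi^2 - lambda / c1; for a
    guided mode both are positive, and the transverse profile is a multiple of
    sin (mu x) below the interface h0 and of sinh (kappa (H - x)) above it.
    Since the profile is only assumed to be a weak H^2 solution, this requires
    a regularity argument (mode_primitives): eliminating the weak derivative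
    shows that u plus q times a second primitive of u is orthogonal to all
    second derivatives of test functions, hence affine (du_bois_reymond2).

    Matching value and derivative at h0 gives the dispersion relation
    tan (mu h0) = - mu tanh (kappa L) / kappa with L = H - h0
    (mode_explicit), and every solution of it yields a mode (dispersion_mode).
    For fixed k the left-hand side increases and the right-hand side decreases
    in mu, so each interval ((n + 1/2) pi, (n + 1) pi) contains at most one
    value of mu h0, and it contains one as long as kappa stays real
    (dispersion_uniq, dispersion_exists).  As no mode has lambda <= k^2 pi^2
    (mode_lower_bound), the l-th eigenvalue belongs to the l-th interval
    (spectrum_branch).  When k grows with l fixed, mu stays bounded, kappa
    tends to infinity, hence sin (mu h0) tends to 0 and mu h0 to l pi (M_cvg).

    The norms factor by Fubini (sqnorm_product, mode_norms).  The integral of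
    sin^2 (k pi x) over omega1 tends to half the measure of omega1 by the
    Riemann-Lebesgue lemma, obtained here from Bessel's inequality.  The
    integral of the profile is h0 / 2 in the limit, all of it from the lower
    layer (energy_cvg); above the interface the squared amplitude is
    (mu / kappa)^2 up to a factor tending to 1, and integrating
    exp (- 2 kappa (x - h0)) from a on contributes another
    exp (- 2 kappa (a - h0)) / (2 kappa) (tail_cvg).  Finally kappa is
    sqrt ((c1 - 1) / c1) sqrt lambda up to an error tending to 0
    (ka_diff_cvg), which allows the substitution inside the exponential. *)

(** * Differential calculus on the line and primitives *)

(** Kept as a definition: otherwise instance resolution on [is_derive] would
    choose the shape of the derivative. *)
Definition derives {R : realType} (F f : R -> R) :=
  forall x : R, is_derive x (1 : R) F (f x).

(** Locked: atoms of ring expressions are compared up to conversion, and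
    [sinh t] and [cosh t] differ only in one sign inside their definitions. *)
HB.lock Definition sinh {R : realType} (x : R) : R := (expR x - expR (- x)) / 2.
HB.lock Definition cosh {R : realType} (x : R) : R := (expR x + expR (- x)) / 2.

Lemma sinhE {R : realType} (x : R) : sinh x = (expR x - expR (- x)) / 2.
Proof. by rewrite unlock. Qed.

Lemma coshE {R : realType} (x : R) : cosh x = (expR x + expR (- x)) / 2.
Proof. by rewrite unlock. Qed.

Section Rules.
Context {R : realType}.
Implicit Types (f g F G : R -> R) (k : R).

Lemma derives_eq F f g : derives F f -> f =1 g -> derives F g.
Proof. by move=> dF fg x; rewrite -fg. Qed.

Lemma derives_cst k : derives (fun=> k : R) (fun=> 0 : R).
Proof. by move=> x; exact: is_derive_cst. Qed.

Lemma derives_id : derives (fun x : R => x) (fun=> 1 : R).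
Proof. by move=> x; exact: is_derive_id. Qed.

Lemma derivesN F f : derives F f -> derives (fun x => - F x) (fun x => - f x).
Proof. by move=> dF x; exact: is_deriveN. Qed.

Lemma derivesD F G f g : derives F f -> derives G g ->
  derives (fun x => F x + G x) (fun x => f x + g x).
Proof. by move=> dF dG x; exact: is_deriveD. Qed.

Lemma derivesM F G f g : derives F f -> derives G g ->
  derives (fun x => F x * G x) (fun x => F x * g x + f x * G x).
Proof.
by move=> dF dG x; rewrite [f x * G x]mulrC; exact: is_deriveM.
Qed.

Lemma derives_comp F G f g : derives F f -> derives G g ->
  derives (fun x => G (F x)) (fun x => g (F x) * f x).
Proof. by move=> dF dG x; exact: is_derive1_comp. Qed.

Lemma derives_sin F f : derives F f ->
  derives (fun x => sin (F x)) (fun x => cos (F x) * f x).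
Proof.
by move=> dF; apply: (@derives_comp F sin f cos) => // x; exact: is_derive_sin.
Qed.

Lemma derives_cos F f : derives F f ->
  derives (fun x => cos (F x)) (fun x => - sin (F x) * f x).
Proof.
by move=> dF; apply: (@derives_comp F cos f (fun x => - sin x)) => // x; exact: is_derive_cos.
Qed.

Lemma derives_expR F f : derives F f ->
  derives (fun x => expR (F x)) (fun x => expR (F x) * f x).
Proof.
by move=> dF; apply: (@derives_comp F expR f expR) => // x; exact: is_derive_expR.
Qed.

Lemma derivesX F f n : derives F f ->
  derives (fun x => F x ^+ n) (fun x => n%:R * F x ^+ n.-1 * f x).
Proof.
move=> dF; elim: n => [|n IH].
  by apply: derives_eq; [exact: (derives_cst 1)|move=> x; rewrite !mul0r].
rewrite (_ : (fun x => F x ^+ n.+1) = (fun x => F x * F x ^+ n)); last first.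
  by apply/funext => x; rewrite exprS.
apply: derives_eq; first exact: (derivesM dF IH).
move=> x /=.
by case: n {IH} => [|n] /=; rewrite ?expr0 ?exprS -?[n.+2%:R]natr1; ring.
Qed.

Lemma is_derive_continuous F f :
  derives F f -> continuous F.
Proof.
move=> dF x; apply: differentiable_continuous; apply/derivable1_diffP.
exact: (@ex_derive _ _ _ _ _ _ _ (dF x)).
Qed.

Lemma continuous_cstf k : continuous (fun _ : R => k).
Proof. by move=> x; exact: cst_continuous. Qed.

Lemma continuous_idf : continuous (fun x : R => x).
Proof. by move=> x; exact: cvg_id. Qed.

Lemma continuousNf F : continuous F -> continuous (fun x => - F x).
Proof. by move=> cF x; apply: (@continuousN _ _ _ F); exact: cF. Qed.

Lemma continuousDf F G : continuous F -> continuous G ->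
  continuous (fun x => F x + G x).
Proof.
by move=> cF cG x; apply: (@continuousD _ _ _ F G); [exact: cF|exact: cG].
Qed.

Lemma continuousMf F G : continuous F -> continuous G ->
  continuous (fun x => F x * G x).
Proof.
by move=> cF cG x; apply: (@continuousM _ _ F G); [exact: cF|exact: cG].
Qed.

Lemma continuousXf F n : continuous F -> continuous (fun x => F x ^+ n).
Proof.
move=> cF; elim: n => [|n IH].
  exact: continuous_cstf.
rewrite (_ : (fun x => F x ^+ n.+1) = (fun x => F x * F x ^+ n)).
  exact: continuousMf.
by apply/funext => x; rewrite exprS.
Qed.

Lemma continuous_compf F G : continuous F -> continuous G ->
  continuous (fun x => G (F x)).
Proof. by move=> cF cG x; apply: continuous_comp; [exact: cF|exact: cG]. Qed.

Lemma continuous_sinf F : continuous F -> continuous (fun x => sin (F x)).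
Proof. by move/continuous_compf; apply; exact: continuous_sin. Qed.

Lemma continuous_cosf F : continuous F -> continuous (fun x => cos (F x)).
Proof. by move/continuous_compf; apply; exact: continuous_cos. Qed.

Lemma continuous_expRf F : continuous F -> continuous (fun x => expR (F x)).
Proof. by move/continuous_compf; apply; exact: continuous_expR. Qed.

Lemma continuous_normf F : continuous F -> continuous (fun x => `|F x|).
Proof. by move/continuous_compf; apply; exact: norm_continuous. Qed.

Lemma derives_sinh F f : derives F f ->
  derives (fun x => sinh (F x)) (fun x => cosh (F x) * f x).
Proof.
move=> dF.
rewrite (_ : (fun x => sinh (F x)) = fun x => (expR (F x) - expR (- F x)) / 2); last first.
  by apply/funext => x; rewrite sinhE.
apply: derives_eq.
  apply: derivesM; last exact: derives_cst.
  apply: derivesD; first exact: derives_expR dF.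
  by apply/derivesN/derives_expR/derivesN; exact: dF.
by move=> x /=; rewrite ?sinhE ?coshE; field.
Qed.

Lemma derives_cosh F f : derives F f ->
  derives (fun x => cosh (F x)) (fun x => sinh (F x) * f x).
Proof.
move=> dF.
rewrite (_ : (fun x => cosh (F x)) = fun x => (expR (F x) + expR (- F x)) / 2); last first.
  by apply/funext => x; rewrite coshE.
apply: derives_eq.
  apply: derivesM; last exact: derives_cst.
  apply: derivesD; first exact: derives_expR dF.
  by apply/derives_expR/derivesN; exact: dF.
by move=> x /=; rewrite ?sinhE ?coshE; field.
Qed.

Lemma continuous_sinhf F : continuous F -> continuous (fun x => sinh (F x)).
Proof.
move=> cF; apply: (continuous_compf cF (is_derive_continuous _)).
exact: derives_sinh derives_id.
Qed.

Lemma continuous_coshf F : continuous F -> continuous (fun x => cosh (F x)).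
Proof.
move=> cF; apply: (continuous_compf cF (is_derive_continuous _)).
exact: derives_cosh derives_id.
Qed.

End Rules.

Ltac derive_rules :=
  repeat lazymatch goal with
    | |- derives (fun _ => ?k) _ => apply: derives_cst
    | |- derives (fun x => x) _ => apply: derives_id
    | |- derives (fun x => - (@?f x)) _ => apply: derivesN
    | |- derives (fun x => @?f x + @?g x) _ => apply: derivesD
    | |- derives (fun x => @?f x * @?g x) _ => apply: derivesM
    | |- derives (-%R) _ => apply: (derivesN derives_id)
    | |- derives ( *%R ?k) _ => apply: (derivesM (derives_cst k) derives_id)
    | |- derives (+%R ?k) _ => apply: (derivesD (derives_cst k) derives_id)
    | |- derives (fun x => @?f x ^+ ?n) _ => apply: derivesX
    | |- derives (fun x => sin (@?f x)) _ => apply: derives_sin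
    | |- derives (fun x => cos (@?f x)) _ => apply: derives_cos
    | |- derives (fun x => expR (@?f x)) _ => apply: derives_expR
    | |- derives (fun x => sinh (@?f x)) _ => apply: derives_sinh
    | |- derives (fun x => cosh (@?f x)) _ => apply: derives_cosh
    | |- derives _ _ => eassumption
    end.

Ltac continuity_rules :=
  repeat lazymatch goal with
    | |- continuous (fun _ => ?k) => apply: continuous_cstf
    | |- continuous (fun x => x) => apply: continuous_idf
    | |- continuous (fun x => - (@?f x)) => apply: continuousNf
    | |- continuous (fun x => @?f x + @?g x) => apply: continuousDf
    | |- continuous (fun x => @?f x * @?g x) => apply: continuousMf
    | |- continuous (-%R) => exact (continuousNf (@continuous_idf _))
    | |- continuous ( *%R ?k) =>
        exact (continuousMf (@continuous_cstf _ k) (@continuous_idf _))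
    | |- continuous (+%R ?k) =>
        exact (continuousDf (@continuous_cstf _ k) (@continuous_idf _))
    | |- continuous (fun x => @?f x ^+ ?n) => apply: continuousXf
    | |- continuous (fun x => sin (@?f x)) => apply: continuous_sinf
    | |- continuous (fun x => cos (@?f x)) => apply: continuous_cosf
    | |- continuous (fun x => expR (@?f x)) => apply: continuous_expRf
    | |- continuous (fun x => `|@?f x|) => apply: continuous_normf
    | |- continuous (fun x => sinh (@?f x)) => apply: continuous_sinhf
    | |- continuous (fun x => cosh (@?f x)) => apply: continuous_coshf
    | |- continuous _ => eassumption
    end.

Section Calculus.
Context {R : realType}.
Implicit Types (f g F : R -> R) (a b c k : R).

Lemma integrable_itvoo f a b : continuous f ->
  (leb1 R).-integrable `]a, b[ (EFin \o f).
Proof.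
move=> cf; apply: (@integrableS _ _ _ (leb1 R) `[a, b]) => //.
  exact: subset_itv_oo_cc.
apply: continuous_compact_integrable; first exact: segment_compact.
exact: continuous_subspaceT.
Qed.

Lemma integral_itvoo_cc f a b : continuous f ->
  \int[leb1 R]_(x in `]a, b[) f x = \int[leb1 R]_(x in `[a, b]) f x.
Proof.
move=> cf.
have cfi : (leb1 R).-integrable `[a, b] (EFin \o f).
  apply: continuous_compact_integrable; first exact: segment_compact.
  exact: continuous_subspaceT.
rewrite Rintegral_itv_bndo_bndc; last exact: integrable_itvoo.
rewrite Rintegral_itv_obnd_cbnd //.
by apply: integrableS cfi => //; exact: subset_itv_oc_cc.
Qed.

Lemma integral_derive F f a b : a <= b ->
  derives F f -> continuous f ->
  \int[leb1 R]_(x in `]a, b[) f x = F b - F a.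
Proof.
move=> + dF cf; rewrite le_eqVlt => /predU1P[->|ab].
  by rewrite set_itvoo0 ?Rintegral_set0 ?subrr// ltxx.
rewrite integral_itvoo_cc// /Rintegral (@continuous_FTC2 _ f F)//.
- exact: continuous_subspaceT.
- have cF := is_derive_continuous dF.
  split.
  + by move=> x _; exact: (@ex_derive _ _ _ _ _ _ _ (dF x)).
  + by apply: cvg_at_right_filter; exact: cF.
  + by apply: cvg_at_left_filter; exact: cF.
- by move=> x _; rewrite derive1E (@derive_val _ _ _ _ _ _ _ (dF x)).
Qed.

(** The primitive is the integral from minus infinity, which exists because
    [f] vanishes to the left of [c]. *)
Lemma antiderivative f c : continuous f -> (forall x, x <= c -> f x = 0) ->
  exists F, derives F f /\
            (forall x, x <= c -> F x = 0).
Proof.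
move=> cf f0.
pose F x := \int[leb1 R]_(t in `]-oo, x]) f t.
exists F; split=> x.
  pose u := Num.max c x + 1.
  have cu : c <= u by rewrite /u -[c]addr0 lerD// le_max addr0 lexx.
  have xu : x < u by rewrite ltr_pwDr// le_max lexx orbT.
  have fi : (leb1 R).-integrable `]-oo, u] (EFin \o f).
    have cui : (leb1 R).-integrable `[c, u] (EFin \o f).
      apply: continuous_compact_integrable; first exact: segment_compact.
      exact: continuous_subspaceT.
    move/integrable_mkcond : cui => /(_ (measurable_itv _)) cui.
    have := @integrableS _ _ _ (leb1 R) setT `]-oo, u] _ measurableT
      (measurable_itv _) (@subsetT _ _) cui.
    apply: eq_integrable => // t.
    rewrite inE /= in_itv /= => tu; rewrite patchE.
    case: ifPn => //; rewrite notin_setE /= in_itv /= tu andbT => /negP.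
    by rewrite -ltNge => /ltW/f0 ->.
  have [dF F'] := @continuous_FTC1 R f -oo%O x u xu fi (ltNyr x) (cf x).
  by rewrite derive1E in F'; exact: (DeriveDef dF F').
move=> xc; rewrite /F (@eq_Rintegral _ _ _ _ _ (cst 0)).
  by rewrite Rintegral_cst//= mul0r.
by move=> t; rewrite inE/= in_itv/= => tx; rewrite f0// (le_trans tx).
Qed.


Lemma integralDf f g a b : continuous f -> continuous g ->
  \int[leb1 R]_(x in `]a, b[) (f x + g x) =
  \int[leb1 R]_(x in `]a, b[) f x + \int[leb1 R]_(x in `]a, b[) g x.
Proof. by move=> cf cg; rewrite RintegralD//; exact: integrable_itvoo. Qed.

Lemma integralZf f k a b : continuous f ->
  \int[leb1 R]_(x in `]a, b[) (k * f x) =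
  k * \int[leb1 R]_(x in `]a, b[) f x.
Proof. by move=> cf; rewrite RintegralZl//; exact: integrable_itvoo. Qed.

Lemma integral_itvoo_split f a b c : a <= c -> c <= b ->
  (leb1 R).-integrable `]a, b[ (EFin \o f) ->
  \int[leb1 R]_(x in `]a, b[) f x =
  \int[leb1 R]_(x in `]a, c[) f x + \int[leb1 R]_(x in `]c, b[) f x.
Proof.
move=> ac; rewrite le_eqVlt => /predU1P[->|cb] fi.
  by rewrite [in X in _ + X]set_itvoo0 ?ltxx// Rintegral_set0 addr0.
have := @Rintegral_itvB R f (BRight a) (BLeft b) c fi.
rewrite !bnd_simp => /(_ ac cb) <-.
have sub : `]a, c[ `<=` `]a, b[ by apply: subset_itvl; rewrite bnd_simp ltW.
have fc := @integrableS _ _ _ (leb1 R) `]a, b[ `]a, c[ _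
  (measurable_itv _) (measurable_itv _) sub fi.
by rewrite (Rintegral_itv_bndo_bndc (a := BRight a) (r := c) fc) subrKC.
Qed.

End Calculus.

(** * The du Bois-Reymond lemma of second order *)

Section DuBoisReymond.
Context {R : realType}.
Implicit Types (f g D phi : R -> R) (a b m r H : R).

Lemma continuous_eq0_closure f a b : a < b -> continuous f ->
  (forall x, a < x < b -> f x = 0) -> forall x, a <= x <= b -> f x = 0.
Proof.
move=> ab cf f0 x /andP[].
rewrite le_eqVlt => /predU1P[<- _|ax].
  apply: (@cvg_unique _ _ (f t @[t --> a^'+])) => //.
    exact/cvg_at_right_filter/cf.
  apply: cvg_near_cst; near=> t; apply: f0; apply/andP; split; near: t.
    exact: nbhs_right_gt.
  exact: nbhs_right_lt.
rewrite le_eqVlt => /predU1P[->|xb]; last by apply: f0; rewrite ax.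
apply: (@cvg_unique _ _ (f t @[t --> b^'-])) => //.
  exact/cvg_at_left_filter/cf.
apply: cvg_near_cst; near=> t; apply: f0; apply/andP; split; near: t.
  exact: nbhs_left_gt.
exact: nbhs_left_lt.
Unshelve. all: by end_near. Qed.

Lemma derives_cst_itv F f a b : a <= b -> derives F f ->
  (forall x, a <= x <= b -> f x = 0) -> F b = F a.
Proof.
move=> ab dF f0.
have cF := continuous_subspaceT (is_derive_continuous dF).
have [c cab /eqP] := MVT_segment ab (fun x _ => dF x) (cF _).
by rewrite f0 ?mul0r ?subr_eq0 => [/eqP//|]; move: cab; rewrite in_itv.
Qed.

Lemma derives_nondecreasing F f a b : a <= b -> derives F f ->
  (forall x, a <= x <= b -> 0 <= f x) -> F a <= F b.
Proof.
move=> ab dF f0.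
have cF := continuous_subspaceT (is_derive_continuous dF).
have [c cab FE] := MVT_segment ab (fun x _ => dF x) (cF _).
rewrite -subr_ge0 FE mulr_ge0 ?subr_ge0// f0//.
Qed.

(** If [f] were positive at some point it would be so on a small interval, on
    which its primitive [F] would increase strictly. *)
Lemma integral_eq0_continuous F f a b : derives F f -> continuous f ->
  (forall x, a <= x <= b -> 0 <= f x) -> F b <= F a ->
  forall x, a < x < b -> f x = 0.
Proof.
move=> dF cf f0 Fba x /andP[ax xb]; apply/eqP; rewrite eq_le.
apply/andP; split; last by apply: f0; rewrite !ltW.
rewrite leNgt; apply/negP => fx.
have /nbhs_ballP[/= d d0 dP] : \forall t \near x, 0 < f t.
  exact: (cvgr_gt _ (cf x)) fx.
pose e := Num.min (d / 2) (Num.min ((x - a) / 2) ((b - x) / 2)).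
have e0 : 0 < e by rewrite !lt_min !divr_gt0// ?subr_gt0.
have ed : e <= d / 2 by rewrite ge_min lexx.
have ea : e <= (x - a) / 2 by rewrite !ge_min lexx orbT.
have eb : e <= (b - x) / 2 by rewrite !ge_min lexx !orbT.
have cF := continuous_subspaceT (is_derive_continuous dF).
have xe : x - e < x + e by lra.
have [c cab FE] := MVT xe (fun t _ => dF t) (cF _).
have fc : 0 < f c.
  apply: dP; rewrite /ball/= distrC ltr_norml.
  by move: cab; rewrite in_itv/= => /andP[]; lra.
have : F (x - e) < F (x + e).
  by rewrite -subr_gt0 FE mulr_gt0//; lra.
have : F a <= F (x - e).
  by apply: (derives_nondecreasing _ dF) => [|t /andP[? ?]]; [lra|apply: f0; lra].
have : F (x + e) <= F b.
  by apply: (derives_nondecreasing _ dF) => [|t /andP[? ?]]; [lra|apply: f0; lra].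
lra.
Qed.

(** Let [p] be the orthogonal projection of [D] onto affine functions for the
    weight [w], which is positive exactly on the open interval.  Then
    [w (D - p)] has vanishing moments of order 0 and 1, so its second
    primitive is supported in the interval.  Testing with this primitive gives
    a vanishing integral of [w (D - p)^2]. *)
Lemma du_bois_reymond2_local D m r H : 0 < m - r -> 0 < r -> m + r < H ->
  continuous D ->
  (forall phi phi1 phi2 : R -> R,
     derives phi phi1 -> derives phi1 phi2 -> continuous phi2 ->
     (forall x, ~ (m - r <= x <= m + r) -> phi x = 0 /\ phi1 x = 0) ->
     \int[leb1 R]_(x in `]0, H[) (D x * phi2 x) = 0) ->
  exists p0 p1, forall x, m - r <= x <= m + r -> D x = p0 + p1 * (x - m).
Proof.
move=> mr0 r0 mrH cD orth.
pose z t := r ^+ 2 - (t - m) ^+ 2.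
pose w t := (z t + `|z t|) / 2.
have cz : continuous z by rewrite /z; continuity_rules.
have cw : continuous w by rewrite /w; continuity_rules.
have w0 t : 0 <= w t by rewrite divr_ge0// -[z t]opprK -lerBlDl sub0r opprK -normrN ler_norm.
have wz t : m - r <= t <= m + r -> w t = z t.
  move=> /andP[t1 t2]; rewrite /w ger0_norm; first by field.
  by rewrite /z; nra.
have w_out t : ~ (m - r < t < m + r) -> w t = 0.
  move=> tN; rewrite /w ler0_norm ?subrr ?mul0r// /z.
  have [tm|mt] := leP t m.
    have : t <= m - r by rewrite leNgt; apply/negP => ?; apply: tN; apply/andP; lra.
    nra.
  have : m + r <= t by rewrite leNgt; apply/negP => ?; apply: tN; apply/andP; lra.
  nra.
pose a := m - r; pose b := m + r.
have ab : a <= b by rewrite /a /b; lra.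
have int_w (g : R -> R) : \int[leb1 R]_(t in `]a, b[) (w t * g t) =
                 \int[leb1 R]_(t in `]a, b[) (z t * g t).
  apply: eq_Rintegral => t; rewrite inE/= in_itv/= => /andP[t1 t2].
  by rewrite wz// !ltW.
have I0 : \int[leb1 R]_(t in `]a, b[) (w t * 1) = 4 / 3 * r ^+ 3.
  have dK : derives (fun t => r ^+ 2 * t - (t - m) ^+ 3 / 3)
                   (fun t => z t * 1).
    apply: derives_eq; first by derive_rules.
    by move=> t /=; rewrite /z; field.
  have cK : continuous (fun t => z t * 1) by continuity_rules.
  by rewrite int_w (integral_derive ab dK cK) /a /b; field.
have I1 : \int[leb1 R]_(t in `]a, b[) (w t * (t - m)) = 0.
  have dK : derives (fun t => r ^+ 2 * (t - m) ^+ 2 / 2 - (t - m) ^+ 4 / 4)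
                   (fun t => z t * (t - m)).
    apply: derives_eq; first by derive_rules.
    by move=> t /=; rewrite /z; field.
  have cK : continuous (fun t => z t * (t - m)) by continuity_rules.
  by rewrite int_w (integral_derive ab dK cK) /a /b; field.
have I2 : \int[leb1 R]_(t in `]a, b[) (w t * (t - m) ^+ 2) = 4 / 15 * r ^+ 5.
  have dK : derives (fun t => r ^+ 2 * (t - m) ^+ 3 / 3 - (t - m) ^+ 5 / 5)
                   (fun t => z t * (t - m) ^+ 2).
    apply: derives_eq; first by derive_rules.
    by move=> t /=; rewrite /z; field.
  have cK : continuous (fun t => z t * (t - m) ^+ 2) by continuity_rules.
  by rewrite int_w (integral_derive ab dK cK) /a /b; field.
(* Since [w] is even about [m], the functions 1 and [t - m] are orthogonal:
   the coefficients of the projection are two independent quotients. *)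
pose al := \int[leb1 R]_(t in `]a, b[) (w t * D t) / (4 / 3 * r ^+ 3).
pose be := \int[leb1 R]_(t in `]a, b[) (w t * (D t * (t - m))) / (4 / 15 * r ^+ 5).
pose p t := al + be * (t - m).
pose psi t := w t * (D t - p t).
have cp : continuous p by rewrite /p; continuity_rules.
have cpsi : continuous psi by rewrite /psi; continuity_rules.
have J0 : \int[leb1 R]_(t in `]a, b[) psi t = 0.
  rewrite (_ : psi = fun t => w t * D t + (- al * (w t * 1) + - be * (w t * (t - m)))).
    rewrite integralDf; [|by continuity_rules..].
    rewrite integralDf; [|by continuity_rules..].
    rewrite integralZf; [|by continuity_rules].
    rewrite integralZf; [|by continuity_rules].
    by rewrite I0 I1 /al; field; rewrite gt_eqF.
  by apply/funext => t; rewrite /psi /p; ring.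
have J1 : \int[leb1 R]_(t in `]a, b[) ((t - m) * psi t) = 0.
  rewrite (_ : (fun t => (t - m) * psi t) = fun t => w t * (D t * (t - m)) +
      (- al * (w t * (t - m)) + - be * (w t * (t - m) ^+ 2))).
    rewrite integralDf; [|by continuity_rules..].
    rewrite integralDf; [|by continuity_rules..].
    rewrite integralZf; [|by continuity_rules].
    rewrite integralZf; [|by continuity_rules].
    by rewrite I1 I2 /be; field; rewrite gt_eqF.
  by apply/funext => t; rewrite /psi /p; ring.
have psi_out t : ~ (a < t < b) -> psi t = 0 by move=> tN; rewrite /psi w_out ?mul0r.
have [phi1 [dphi1 phi1a]] : exists F, derives F psi /\ forall t, t <= a -> F t = 0.
  apply: antiderivative => // t ta; apply: psi_out.
  by apply/negP; rewrite negb_and -leNgt ta.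
have cphi1 := is_derive_continuous dphi1.
have [phi [dphi phia]] := antiderivative cphi1 phi1a.
have phi1b : phi1 b = 0.
  by have := integral_derive ab dphi1 cpsi; rewrite J0 (phi1a a)// subr0.
have phib : phi b = 0.
  have dK : derives (fun t => (t - m) * phi1 t - phi t) (fun t => (t - m) * psi t).
    apply: derives_eq; first by derive_rules.
    by move=> t /=; ring.
  have cK : continuous (fun t => (t - m) * psi t) by continuity_rules.
  have := integral_derive ab dK cK.
  rewrite J1 phi1b (phi1a a)// (phia a)// !mulr0 !subr0 sub0r => /esym/eqP.
  by rewrite oppr_eq0 => /eqP.
have phi1_out t : ~ (a <= t <= b) -> phi1 t = 0.
  move=> tN; have [/phi1a//|ta] := leP t a.
  have [tb|bt] := leP t b; first by case: tN; rewrite ltW.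
  rewrite (derives_cst_itv (ltW bt) dphi1)// => x /andP[bx _].
  by apply: psi_out; apply/negP; rewrite negb_and -!leNgt bx orbT.
have phi_out t : ~ (a <= t <= b) -> phi t = 0.
  move=> tN; have [/phia//|ta] := leP t a.
  have [tb|bt] := leP t b; first by case: tN; rewrite ltW.
  rewrite (derives_cst_itv (ltW bt) dphi)// => x /andP[+ _].
  rewrite le_eqVlt => /predU1P[<-//|bx]; apply: phi1_out.
  by apply/negP; rewrite negb_and -!ltNge bx orbT.
have H0 : 0 <= H by lra.
have N0 : ~ (a <= 0 <= b) by apply/negP; rewrite negb_and -!ltNge /a mr0.
have NH : ~ (a <= H <= b).
  by apply/negP; rewrite negb_and -!ltNge /b mrH orbT.
have Dpsi : \int[leb1 R]_(x in `]0, H[) (D x * psi x) = 0.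
  by apply: (orth phi phi1 psi) => // x xN; split; [apply: phi_out|apply: phi1_out].
have ppsi : \int[leb1 R]_(x in `]0, H[) (p x * psi x) = 0.
  have dK : derives (fun x => p x * phi1 x - be * phi x) (fun x => p x * psi x).
    rewrite /p; apply: derives_eq; first by derive_rules.
    by move=> t /=; ring.
  have cK : continuous (fun x => p x * psi x) by continuity_rules.
  rewrite (integral_derive H0 dK cK).
  by rewrite (phi1_out _ NH) (phi1_out _ N0) (phi_out _ NH) (phi_out _ N0); ring.
pose g t := w t * (D t - p t) ^+ 2.
have cg : continuous g by rewrite /g; continuity_rules.
have g_out t : ~ (a < t < b) -> g t = 0 by move=> tN; rewrite /g w_out ?mul0r.
have [G [dG Ga]] : exists F, derives F g /\ forall t, t <= a -> F t = 0.
  apply: antiderivative => // t ta; apply: g_out.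
  by apply/negP; rewrite negb_and -leNgt ta.
have GE : G H <= G 0.
  rewrite -subr_le0 -(integral_derive H0 dG cg).
  rewrite (_ : g = fun x => D x * psi x + -1 * (p x * psi x)).
    rewrite integralDf; [|by continuity_rules..].
    rewrite integralZf; [|by continuity_rules].
    by rewrite Dpsi ppsi mulr0 addr0.
  by apply/funext => t; rewrite /g /psi; ring.
have g0 t : 0 < t < H -> g t = 0.
  apply: integral_eq0_continuous dG cg _ GE t => t _.
  by rewrite mulr_ge0// sqr_ge0.
have D_in t : a < t < b -> D t - p t = 0.
  move=> /andP[ta tb].
  have wt : 0 < w t.
    rewrite wz; last by rewrite !ltW.
    by move: ta tb; rewrite /z /a /b; nra.
  have t0H : 0 < t < H.
    by rewrite (lt_trans mr0 ta) (lt_trans tb mrH).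
  by have /eqP := g0 t t0H; rewrite mulf_eq0 gt_eqF//= expf_eq0/= => /eqP.
exists al, be => t tab; apply/eqP; rewrite -subr_eq0; apply/eqP.
apply: (@continuous_eq0_closure (fun t => D t - p t) a b) => //.
  by rewrite /a /b; lra.
by continuity_rules.
Qed.

(** Every point of the interval lies with the two points [m] and [m + H / 4] in
    a compact centered interval on which [D] is affine, so [D] is the affine
    function interpolating it at these two points. *)
Lemma du_bois_reymond2 D H : 0 < H -> continuous D ->
  (forall phi phi1 phi2 : R -> R,
     derives phi phi1 -> derives phi1 phi2 -> continuous phi2 ->
     (exists r s, [/\ 0 < r, s < H &
        forall x, ~ (r <= x <= s) -> phi x = 0 /\ phi1 x = 0]) ->
     \int[leb1 R]_(x in `]0, H[) (D x * phi2 x) = 0) ->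
  exists p0 p1, forall x, 0 <= x <= H -> D x = p0 + p1 * x.
Proof.
move=> H0 cD orth.
pose m := H / 2.
have loc r : 0 < r -> r < m ->
    exists p0 p1, forall x, m - r <= x <= m + r -> D x = p0 + p1 * (x - m).
  move=> r0 rm; apply: (@du_bois_reymond2_local D m r H) => //.
  - by rewrite subr_gt0.
  - by rewrite /m in rm *; lra.
  move=> phi phi1 phi2 dphi dphi1 cphi2 supp; apply: orth dphi dphi1 cphi2 _.
  exists (m - r), (m + r); split => //; first by rewrite subr_gt0.
  by rewrite /m in rm *; lra.
pose q := H / 4.
pose p1 := (D (m + q) - D m) / q.
have q0 : 0 < q by rewrite divr_gt0.
have D_in x : 0 < x < H -> D x - (D m + p1 * (x - m)) = 0.
  move=> /andP[x0 xH].
  pose r := Num.max q `|x - m|.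
  have qr : q <= r by rewrite le_max lexx.
  have xr : `|x - m| <= r by rewrite le_max lexx orbT.
  have [||a0 [a1 DE]] := loc r; first exact: lt_le_trans qr.
    by rewrite gt_max ltr_norml /q /m; lra.
  have xrm : m - r <= x <= m + r by move: xr; rewrite ler_norml; lra.
  have mrm : m - r <= m <= m + r by lra.
  have qrm : m - r <= m + q <= m + r by lra.
  by rewrite /p1 (DE _ xrm) (DE _ mrm) (DE _ qrm); field; rewrite gt_eqF.
exists (D m - p1 * m), p1 => x xH; apply/eqP; rewrite -subr_eq0; apply/eqP.
have -> : D x - (D m - p1 * m + p1 * x) = D x - (D m + p1 * (x - m)) by ring.
move: x xH; apply: (@continuous_eq0_closure (fun x => D x - (D m + p1 * (x - m)))) => //.
by continuity_rules.
Qed.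

End DuBoisReymond.

(** * Piecewise functions and extensions *)

Section Piecewise.
Context {R : realType}.
Implicit Types (f g : R -> R) (a b c : R).

Lemma measurable_piecewise f g c D : measurable D -> continuous f -> continuous g ->
  measurable_fun D (fun x : R => if x < c then f x else g x).
Proof.
move=> mD cf cg; apply: (@measurable_funTS _ _ (measurableTypeR R) (measurableTypeR R)).
apply: measurable_fun_ifT.
- exact: measurable_fun_ltr.
- exact: continuous_measurable_fun.
- exact: continuous_measurable_fun.
Qed.

Lemma integrable_piecewise f g a b c : continuous f -> continuous g ->
  (leb1 R).-integrable `]a, b[
    (EFin \o (fun x : R => if x < c then f x else g x)).
Proof.
move=> cf cg.
have cfg : continuous (fun x => `|f x| + `|g x|) by continuity_rules.
apply: le_integrable (integrable_itvoo a b cfg) => //.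
  by apply/measurable_EFinP; exact: measurable_piecewise.
move=> x _ /=; rewrite lee_fin [X in _ <= X]ger0_norm ?addr_ge0//.
by case: ifPn => _; rewrite ?lerDl ?lerDr.
Qed.

Lemma integral_piecewise f g a b c : a <= c -> c <= b ->
  continuous f -> continuous g ->
  \int[leb1 R]_(x in `]a, b[) (if x < c then f x else g x) =
  \int[leb1 R]_(x in `]a, c[) f x + \int[leb1 R]_(x in `]c, b[) g x.
Proof.
move=> ac cb cf cg.
rewrite (integral_itvoo_split ac cb (integrable_piecewise a b c cf cg)).
congr (_ + _); apply: eq_Rintegral => x; rewrite inE/= in_itv/= => /andP[x1 x2].
  by rewrite x2.
by rewrite ltNge (ltW x1).
Qed.

End Piecewise.

Section Regularity.
Context {R : realType}.
Implicit Types (u : R -> R) (H : R).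

Lemma derive1_derives (F f : R -> R) : derives F f -> derive1 F = f.
Proof.
by move=> dF; apply/funext => x; rewrite derive1E (@derive_val _ _ _ _ _ _ _ (dF x)).
Qed.

Lemma test1_derives (phi phi1 : R -> R) (r s H : R) : derives phi phi1 ->
  continuous phi1 -> 0 < r -> s < H ->
  (forall x, ~ (r <= x <= s) -> phi x = 0) -> test1 `]0, H[ phi.
Proof.
move=> dphi cphi1 r0 sH supp; split.
- by move=> x; exact: (@ex_derive _ _ _ _ _ _ _ (dphi x)).
- by rewrite (derive1_derives dphi).
exists [set` `[r, s]]; split; first exact: segment_compact.
  by move=> x /=; rewrite !in_itv/= => /andP[rx xs]; rewrite (lt_le_trans r0)// (le_lt_trans xs).
by move=> x /=; rewrite in_itv/=; exact: supp.
Qed.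

(** The extension is constant on each side of the interval. *)
Lemma continuous_extension u H : 0 <= H -> {within `[0, H], continuous u} ->
  exists U : R -> R, [/\ continuous U, forall x, 0 <= x <= H -> U x = u x &
                     forall x, x <= 0 -> U x = u 0].
Proof.
move=> H0 cu; pose cl x := Num.max 0 (Num.min x H).
have cl_in x : 0 <= cl x <= H.
  by rewrite le_max lexx/= ge_max H0 ge_min lexx orbT.
have ccl : continuous cl.
  move=> x; apply: (@continuous_max R R (fun=> 0) (fun x => Num.min x H)).
    exact: cst_continuous.
  apply: (@continuous_min R R (fun x => x) (fun=> H)); first exact: cvg_id.
  exact: cst_continuous.
exists (u \o cl); split.
- move=> x; apply: (@cvg_comp _ _ _ cl u _ (within `[0, H] (nbhs (cl x)))).
    move=> P wP; have h : nbhs x (fun y => `[0, H]%classic (cl y) -> P (cl y)).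
      exact: (ccl x _ wP).
    by apply: filterS h => y; apply; rewrite /= in_itv; exact: cl_in.
  move/subspace_continuousP : cu; apply.
  by rewrite /= in_itv; exact: cl_in.
- move=> x /andP[x0 xH] /=; congr u; rewrite /cl.
  by rewrite (min_idPl _)// (max_idPr _).
- by move=> x x0 /=; congr u; rewrite /cl (max_idPl _)// ge_min x0.
Qed.

End Regularity.

(** * Regularity of transverse modes *)

Section ClassicalMode.
Context {R : realType}.
Variables (H h0 c1 : R).
Hypotheses (h0_gt0 : 0 < h0) (h0_ltH : h0 < H).
Implicit Types (u U phi : R -> R) (lambda : R) (k : nat).

(** In a layer of speed [c], a transverse mode solves
    [u'' + layer_q k lambda c * u = 0]. *)
Definition layer_q k lambda (c : R) := lambda / c - (k%:R * pi) ^+ 2.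

(** Testing the first weak derivative with [phi1] and the second one with [phi]
    eliminates the weak derivative of [u]. *)
Lemma mode_weak k lambda u U : transverse_mode H h0 c1 k lambda u ->
  continuous U -> (forall x, 0 <= x <= H -> U x = u x) ->
  forall phi phi1 phi2 r s, derives phi phi1 -> derives phi1 phi2 ->
    continuous phi2 -> 0 < r -> s < H ->
    (forall x, ~ (r <= x <= s) -> phi x = 0 /\ phi1 x = 0) ->
  \int[leb1 R]_(x in `]0, H[) (U x * phi2 x) =
  \int[leb1 R]_(x in `]0, H[)
    (if x < h0 then - layer_q k lambda 1 * (U x * phi x)
     else - layer_q k lambda c1 * (U x * phi x)).
Proof.
move=> [_ [u1 [u2 [[_ _ [mu2 _] w1 w2] ode]]] _ _ _] cU Uu.
move=> phi phi1 phi2 r s dphi dphi1 cphi2 r0 sH supp.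
have cphi1 := is_derive_continuous dphi1.
have cphi := is_derive_continuous dphi.
have t0 : test1 `]0, H[ phi.
  by apply: (test1_derives dphi cphi1 r0 sH) => x /supp[].
have t1 : test1 `]0, H[ phi1.
  by apply: (test1_derives dphi1 cphi2 r0 sH) => x /supp[].
have {w1} := w1 _ t1; rewrite (derive1_derives dphi1) => W1.
have {w2} := w2 _ t0; rewrite (derive1_derives dphi) => W2.
transitivity (\int[leb1 R]_(x in `]0, H[) (u x * phi2 x)).
  apply: eq_Rintegral => x; rewrite inE/= in_itv/= => /andP[x0 xH].
  by rewrite Uu// !ltW.
rewrite W1 W2 opprK /Rintegral; congr fine; apply: ae_eq_integral => //.
- apply/measurable_EFinP; apply: measurable_funM => //.
  by apply: measurable_funTS; exact: continuous_measurable_fun.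
- apply/measurable_EFinP; apply: measurable_piecewise => //; continuity_rules.
apply: filterS ode; first exact: (ae_filter_ringOfSetsType (leb1 R)).
move=> x ode xI; have := ode xI.
have : U x = u x.
  by apply: Uu; move: xI; rewrite /= in_itv/= => /andP[? ?]; rewrite !ltW.
rewrite /layer_c /layer_q => -> ode'; congr EFin.
have -> : u2 x = - ((lambda / (if x < h0 then 1 else c1) - (k%:R * pi) ^+ 2) * u x).
  by apply/eqP; rewrite -subr_eq0 opprK ode'.
by case: ifP => _; ring.
Qed.

(** Let [A] be the second primitive of [u] with [A h0 = A' h0 = 0].  Then the
    function equal to [- q A] in each layer, with the constant [q] of that
    layer, is C^1 and integrates the equation twice; its difference with [u]
    is affine by [du_bois_reymond2].  Hence in each layer [u] agrees with a
    function twice differentiable on the whole line, and the two functions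
    have the same value and derivative at [h0]. *)
Lemma mode_primitives k lambda u : transverse_mode H h0 c1 k lambda u ->
  exists U y0 z0 y1 z1 : R -> R,
  [/\ [/\ derives y0 z0, derives z0 (fun x => - layer_q k lambda 1 * U x),
          derives y1 z1 & derives z1 (fun x => - layer_q k lambda c1 * U x)],
      forall x, 0 <= x <= h0 -> u x = U x /\ u x = y0 x,
      forall x, h0 <= x <= H -> u x = U x /\ u x = y1 x,
      y0 h0 = y1 h0 & z0 h0 = z1 h0].
Proof.
move=> tm; have [cu _ u0 uH _] := tm.
have H0 : 0 < H by exact: lt_trans h0_ltH.
have [U [cU Uu U0]] := continuous_extension (ltW H0) cu.
have [B1 [dB1 B10]] : exists F, derives F U /\ forall x, x <= 0 -> F x = 0.
  by apply: antiderivative => // x x0; rewrite U0 ?u0.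
have cB1 := is_derive_continuous dB1.
have [B [dB _]] := antiderivative cB1 B10.
pose A1 x := B1 x - B1 h0.
pose A x := B x - B h0 - B1 h0 * (x - h0).
have dA1 : derives A1 U.
  by rewrite /A1; apply: derives_eq; [derive_rules|move=> x /=; ring].
have dA : derives A A1.
  by rewrite /A; apply: derives_eq; [derive_rules|move=> x /=; rewrite /A1; ring].
have cA1 := is_derive_continuous dA1.
have cA := is_derive_continuous dA.
have A0 : A h0 = 0 by rewrite /A; ring.
have A10 : A1 h0 = 0 by rewrite /A1; ring.
pose q0 := layer_q k lambda 1; pose q1 := layer_q k lambda c1.
pose D x := U x + (if x < h0 then q0 * A x else q1 * A x).
have DE x : D x = U x + q0 * A (Num.min x h0) + q1 * A (Num.max x h0).
  rewrite /D; have [xh|xh] := ltP x h0; rewrite ?A0; ring.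
have cD : continuous D.
  rewrite (_ : D = fun x => U x + q0 * A (Num.min x h0) + q1 * A (Num.max x h0)); last first.
    by apply/funext => x; exact: DE.
  have cmin : continuous (fun x => A (Num.min x h0)).
    apply: (continuous_compf _ cA) => x.
    by apply: (@continuous_min R R (fun x => x) (fun=> h0)); [exact: cvg_id|exact: cst_continuous].
  have cmax : continuous (fun x => A (Num.max x h0)).
    apply: (continuous_compf _ cA) => x.
    by apply: (@continuous_max R R (fun x => x) (fun=> h0)); [exact: cvg_id|exact: cst_continuous].
  by continuity_rules.
have [|p0 [p1 Dp]] := du_bois_reymond2 H0 cD.
  move=> phi phi1 phi2 dphi dphi1 cphi2 [r [s [r0 sH supp]]].
  have weak := mode_weak tm cU Uu dphi dphi1 cphi2 r0 sH supp.
  have cphi := is_derive_continuous dphi.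
  have cphi1 := is_derive_continuous dphi1.
  have out x : (x < r) || (s < x) -> phi x = 0 /\ phi1 x = 0.
    by move=> xrs; apply: supp; apply/negP; rewrite negb_and -!ltNge.
  have [p00 p10] : phi 0 = 0 /\ phi1 0 = 0 by apply: out; rewrite r0.
  have [p0H p1H] : phi H = 0 /\ phi1 H = 0 by apply: out; rewrite sH orbT.
  have cPsi : continuous (fun x => A x * phi2 x) by continuity_rules.
  have cUphi : continuous (fun x => U x * phi x) by continuity_rules.
  have dK : derives (fun x => A x * phi1 x - A1 x * phi x)
                    (fun x => A x * phi2 x + -1 * (U x * phi x)).
    by apply: derives_eq; [derive_rules|move=> x /=; ring].
  have cK : continuous (fun x => A x * phi2 x + -1 * (U x * phi x)).
    by continuity_rules.
  (* No boundary terms: at [0] and [H] the test function vanishes, at [h0] the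
     function [A] and its derivative do. *)
  have parts a b : a <= b -> A b * phi1 b - A1 b * phi b = A a * phi1 a - A1 a * phi a ->
      \int[leb1 R]_(x in `]a, b[) (A x * phi2 x) =
      \int[leb1 R]_(x in `]a, b[) (U x * phi x).
    move=> ab e; have := integral_derive ab dK cK.
    rewrite integralDf; [|by continuity_rules..].
    rewrite integralZf; [|by continuity_rules..].
    by rewrite e subrr mulN1r => /eqP; rewrite subr_eq0 => /eqP.
  have parts0 : \int[leb1 R]_(x in `]0, h0[) (A x * phi2 x) =
      \int[leb1 R]_(x in `]0, h0[) (U x * phi x).
    by apply: parts; [exact: ltW|rewrite A0 A10 p00 p10; ring].
  have parts1 : \int[leb1 R]_(x in `]h0, H[) (A x * phi2 x) =
      \int[leb1 R]_(x in `]h0, H[) (U x * phi x).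
    by apply: parts; [exact: ltW|rewrite A0 A10 p0H p1H; ring].
  move: weak; rewrite integral_piecewise ?ltW//; [|by continuity_rules..].
  rewrite integralZf; [|by continuity_rules..].
  rewrite integralZf; [|by continuity_rules..].
  rewrite -parts0 -parts1 => weak.
  transitivity (\int[leb1 R]_(x in `]0, H[) (U x * phi2 x) +
    \int[leb1 R]_(x in `]0, H[) (if x < h0 then q0 * (A x * phi2 x) else q1 * (A x * phi2 x))).
    rewrite -RintegralD//; last 2 first.
    - by apply: integrable_itvoo; continuity_rules.
    - by apply: integrable_piecewise; continuity_rules.
    by apply: eq_Rintegral => x _; rewrite /D; case: ifP => _; ring.
  rewrite integral_piecewise ?ltW//; [|by continuity_rules..].
  rewrite integralZf; [|by continuity_rules..].
  rewrite integralZf; [|by continuity_rules..].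
  by rewrite weak /q0 /q1; ring.
exists U, (fun x => p0 + p1 * x - q0 * A x), (fun x => p1 - q0 * A1 x),
  (fun x => p0 + p1 * x - q1 * A x), (fun x => p1 - q1 * A1 x); split.
- split; apply: derives_eq; try (by derive_rules); move=> x /=; rewrite ?/q0 ?/q1; ring.
- move=> x /andP[x0 xh].
  have xH : 0 <= x <= H by rewrite x0 (le_trans xh)// ltW.
  rewrite -Uu//; split => //; have := Dp x xH; rewrite DE (min_idPl xh) (max_idPr xh) A0.
  by move=> <-; ring.
- move=> x /andP[hx xH'].
  have xH : 0 <= x <= H by rewrite xH' andbT (le_trans (ltW h0_gt0)).
  rewrite -Uu//; split => //; have := Dp x xH; rewrite DE (min_idPr hx) (max_idPl hx) A0.
  by move=> <-; ring.
- by rewrite A0; ring.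
- by rewrite A10; ring.
Qed.

End ClassicalMode.

(** * Explicit form of the modes and the dispersion relation *)

Section Hyperbolic.
Context {R : realType}.
Implicit Types (x y p q : R).

Lemma cosh_gt0 x : 0 < cosh x.
Proof. by rewrite coshE divr_gt0// addr_gt0// expR_gt0. Qed.

Lemma sinh0 : sinh (0 : R) = 0.
Proof. by rewrite sinhE oppr0 subrr mul0r. Qed.

Lemma cosh0 : cosh (0 : R) = 1.
Proof. by rewrite coshE oppr0 expR0; field. Qed.

Lemma sinh_gt0 x : 0 < x -> 0 < sinh x.
Proof. by move=> x0; rewrite sinhE divr_gt0// subr_gt0 ltr_expR; lra. Qed.

Lemma sinh_ge0 x : 0 <= x -> 0 <= sinh x.
Proof. by rewrite le_eqVlt => /predU1P[<-|/sinh_gt0/ltW//]; rewrite sinh0. Qed.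

Lemma cosh2Bsinh2 x : cosh x ^+ 2 - sinh x ^+ 2 = 1.
Proof.
have e : expR x * expR (- x) = 1 by rewrite -expRD subrr expR0.
by rewrite -[RHS]e coshE sinhE; field.
Qed.

Lemma sinhD x y : sinh (x + y) = sinh x * cosh y + cosh x * sinh y.
Proof. by rewrite !sinhE !coshE opprD !expRD; field. Qed.

Lemma sinhN x : sinh (- x) = - sinh x.
Proof. by rewrite !sinhE opprK; field. Qed.

Lemma coshN x : cosh (- x) = cosh x.
Proof. by rewrite !coshE opprK; field. Qed.

Lemma cosh_homo x y : 0 <= x -> x <= y -> cosh x <= cosh y.
Proof.
move=> x0 xy.
have d : derives cosh (fun x : R => sinh x * 1) by exact: derives_cosh derives_id.
apply: (derives_nondecreasing xy d) => t /andP[xt _].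
by rewrite mulr1 sinh_ge0// (le_trans x0).
Qed.

(** The function [p * sinh (t * q) - q * sinh (t * p)] vanishes at [t = 0] and
    has derivative [p * q * (cosh (t * q) - cosh (t * p)) >= 0]; take [t = 1]. *)
Lemma sinh_superlinear p q : 0 <= p -> p <= q -> q * sinh p <= p * sinh q.
Proof.
move=> p0 pq.
have q0 := le_trans p0 pq.
have d : derives (fun t => p * sinh (t * q) - q * sinh (t * p))
                 (fun t => p * q * (cosh (t * q) - cosh (t * p))).
  by apply: derives_eq; [derive_rules|move=> t /=; ring].
have := derives_nondecreasing ler01 d.
rewrite !mul1r !mul0r sinh0 !mulr0 subr0 subr_ge0; apply => t /andP[t0 t1].
by rewrite !mulr_ge0// subr_ge0 cosh_homo ?ler_wpM2l// mulr_ge0.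
Qed.

(** The function [tanh x / x] is nonincreasing: by the addition formulas this is
    [sinh_superlinear] for [x - y] and [x + y]. *)
Lemma tanh_ratio x y : 0 <= y -> y <= x ->
  y * (sinh x * cosh y) <= x * (sinh y * cosh x).
Proof.
move=> y0 yx.
have := @sinh_superlinear (x - y) (x + y).
rewrite subr_ge0 => /(_ yx); rewrite !sinhD sinhN coshN => /(_ _).
have h : x - y <= x + y by lra.
by move=> /(_ h); nra.
Qed.

End Hyperbolic.

Section ODE.
Context {R : realType}.
Implicit Types (y z U : R -> R) (a b mu kappa : R).

(** The Wronskians of [y] with [sin (mu x)] and [cos (mu x)] are constant. *)
Lemma oscillator_solution y z U mu b : 0 < mu -> 0 <= b ->
  derives y z -> derives z (fun x => - mu ^+ 2 * U x) ->
  (forall x, 0 <= x <= b -> U x = y x) -> y 0 = 0 ->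
  forall x, 0 <= x <= b ->
    mu * y x = z 0 * sin (mu * x) /\ z x = z 0 * cos (mu * x).
Proof.
move=> mu0 b0 dy dz Uy y0 x /andP[x0 xb].
have dP : derives (fun x => mu * y x * sin (mu * x) + z x * cos (mu * x))
                  (fun x => mu ^+ 2 * (y x - U x) * cos (mu * x)).
  by apply: derives_eq; [derive_rules|move=> t /=; ring].
have dQ : derives (fun x => mu * y x * cos (mu * x) - z x * sin (mu * x))
                  (fun x => mu ^+ 2 * (U x - y x) * sin (mu * x)).
  by apply: derives_eq; [derive_rules|move=> t /=; ring].
have Ux t : 0 <= t <= x -> U t = y t.
  by move=> /andP[t0 tx]; rewrite Uy// t0 (le_trans tx).
have P : mu * y x * sin (mu * x) + z x * cos (mu * x) = z 0.
  rewrite (derives_cst_itv x0 dP); first by rewrite mulr0 sin0 cos0; ring.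
  by move=> t /Ux ->; ring.
have Q : mu * y x * cos (mu * x) - z x * sin (mu * x) = 0.
  rewrite (derives_cst_itv x0 dQ); first by rewrite mulr0 sin0 cos0 y0; ring.
  by move=> t /Ux ->; ring.
have cs := cos2Dsin2 (mu * x).
split.
  rewrite -[LHS]mulr1 -cs -P.
  transitivity (mu * y x * (cos (mu * x) ^+ 2 + sin (mu * x) ^+ 2)
    - cos (mu * x) * (mu * y x * cos (mu * x) - z x * sin (mu * x))); last by ring.
  by rewrite Q; ring.
rewrite -[LHS]mulr1 -cs -P.
transitivity (z x * (cos (mu * x) ^+ 2 + sin (mu * x) ^+ 2)
    + sin (mu * x) * (mu * y x * cos (mu * x) - z x * sin (mu * x))); last by ring.
by rewrite Q; ring.
Qed.

(** The Wronskians of [y] with the hyperbolic functions are constant. *)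
Lemma evanescent_solution y z U kappa a b : a <= b ->
  derives y z -> derives z (fun x => kappa ^+ 2 * U x) ->
  (forall x, a <= x <= b -> U x = y x) -> y b = 0 ->
  forall x, a <= x <= b ->
    kappa * y x = - z b * sinh (kappa * (b - x)) /\
    z x = z b * cosh (kappa * (b - x)).
Proof.
move=> ab dy dz Uy yb x /andP[ax xb].
have dP : derives
    (fun x => kappa * y x * cosh (kappa * (b - x)) + z x * sinh (kappa * (b - x)))
    (fun x => kappa ^+ 2 * (U x - y x) * sinh (kappa * (b - x))).
  by apply: derives_eq; [derive_rules|move=> t /=; ring].
have dQ : derives
    (fun x => kappa * y x * sinh (kappa * (b - x)) + z x * cosh (kappa * (b - x)))
    (fun x => kappa ^+ 2 * (U x - y x) * cosh (kappa * (b - x))).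
  by apply: derives_eq; [derive_rules|move=> t /=; ring].
have Ux t : x <= t <= b -> U t = y t.
  by move=> /andP[xt tb]; rewrite Uy// tb (le_trans ax).
have P : kappa * y x * cosh (kappa * (b - x)) + z x * sinh (kappa * (b - x)) = 0.
  rewrite -(derives_cst_itv xb dP); first by rewrite subrr mulr0 sinh0 cosh0 yb; ring.
  by move=> t /Ux ->; ring.
have Q : kappa * y x * sinh (kappa * (b - x)) + z x * cosh (kappa * (b - x)) = z b.
  rewrite -(derives_cst_itv xb dQ); first by rewrite subrr mulr0 sinh0 cosh0; ring.
  by move=> t /Ux ->; ring.
have cs := cosh2Bsinh2 (kappa * (b - x)).
split.
  rewrite -[LHS]mulr1 -cs -Q.
  transitivity (kappa * y x * (cosh (kappa * (b - x)) ^+ 2 - sinh (kappa * (b - x)) ^+ 2)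
    - cosh (kappa * (b - x)) *
     (kappa * y x * cosh (kappa * (b - x)) + z x * sinh (kappa * (b - x)))); last by ring.
  by rewrite P; ring.
rewrite -[LHS]mulr1 -cs -Q.
transitivity (z x * (cosh (kappa * (b - x)) ^+ 2 - sinh (kappa * (b - x)) ^+ 2)
    + sinh (kappa * (b - x)) *
     (kappa * y x * cosh (kappa * (b - x)) + z x * sinh (kappa * (b - x)))); last by ring.
by rewrite P; ring.
Qed.

End ODE.

Section Modes.
Context {R : realType}.
Variables (H h0 c1 : R).
Hypotheses (h0_gt0 : 0 < h0) (h0_ltH : h0 < H) (c1_gt1 : 1 < c1).
Implicit Types (u : R -> R) (lambda mu kappa : R) (k : nat).

(** If [lambda <= k^2 pi^2] then [u'' = q u] with [q >= 0] in both layers, so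
    [u u'] is nondecreasing; it vanishes at both ends, hence everywhere, and
    [u^2] is constant. *)
Lemma mode_lower_bound k lambda u : transverse_mode H h0 c1 k lambda u ->
  (k%:R * pi) ^+ 2 < lambda.
Proof.
move=> tm; rewrite ltNge; apply/negP => lamK.
have [U [y0 [z0 [y1 [z1 [[dy0 dz0 dy1 dz1] u0E u1E yh zh]]]]]] :=
  mode_primitives h0_gt0 h0_ltH tm.
have [_ _ u0 uH [x xI]] := tm; apply.
have K0 : 0 <= (k%:R * pi) ^+ 2 :> R by exact: sqr_ge0.
have q0 : 0 <= - layer_q k lambda 1 by rewrite /layer_q divr1 oppr_ge0 subr_le0.
have q1 : 0 <= - layer_q k lambda c1.
  rewrite /layer_q oppr_ge0 subr_le0 ler_pdivrMr ?(lt_trans ltr01 c1_gt1)//.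
  by rewrite (le_trans lamK)// ler_peMr// ltW.
have dE0 : derives (fun x => y0 x * z0 x)
    (fun x => z0 x ^+ 2 + - layer_q k lambda 1 * (U x * y0 x)).
  by apply: derives_eq; [derive_rules|move=> t /=; ring].
have dE1 : derives (fun x => y1 x * z1 x)
    (fun x => z1 x ^+ 2 + - layer_q k lambda c1 * (U x * y1 x)).
  by apply: derives_eq; [derive_rules|move=> t /=; ring].
have U0 t : 0 <= t <= h0 -> U t = y0 t by move=> /u0E[<-].
have U1 t : h0 <= t <= H -> U t = y1 t by move=> /u1E[<-].
have E0 a b : 0 <= a -> a <= b -> b <= h0 -> y0 a * z0 a <= y0 b * z0 b.
  move=> a0 ab bh; apply: (derives_nondecreasing ab dE0) => t /andP[t0 th].
  rewrite U0; first by rewrite addr_ge0 ?sqr_ge0// mulr_ge0// -expr2 sqr_ge0.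
  by rewrite (le_trans a0)// (le_trans th).
have E1 a b : h0 <= a -> a <= b -> b <= H -> y1 a * z1 a <= y1 b * z1 b.
  move=> a0 ab bh; apply: (derives_nondecreasing ab dE1) => t /andP[t0 th].
  rewrite U1; first by rewrite addr_ge0 ?sqr_ge0// mulr_ge0// -expr2 sqr_ge0.
  by rewrite (le_trans a0)// (le_trans th).
have y00 : y0 0 = 0 by have [] := u0E 0; rewrite ?lexx ?ltW// => _ <-.
have y1H : y1 H = 0 by have [] := u1E H; rewrite ?lexx ?ltW// => _ <-.
have Eh : y1 h0 * z1 h0 <= 0.
  by have := E1 h0 H (lexx _) (ltW h0_ltH) (lexx _); rewrite y1H mul0r.
have Eh0 : 0 <= y0 h0 * z0 h0.
  by have := E0 0 h0 (lexx _) (ltW h0_gt0) (lexx _); rewrite y00 mul0r.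
have Z0 t : 0 <= t <= h0 -> y0 t * z0 t = 0.
  move=> /andP[t0 th]; apply/eqP; rewrite eq_le.
  rewrite (le_trans (E0 _ _ t0 th (lexx _))) ?yh ?zh//=.
  by rewrite (le_trans _ (E0 _ _ (lexx _) t0 th))// y00 mul0r.
have Z1 t : h0 <= t <= H -> y1 t * z1 t = 0.
  move=> /andP[t0 th]; apply/eqP; rewrite eq_le.
  rewrite (le_trans (E1 _ _ t0 th (lexx _))) ?y1H ?mul0r//=.
  by rewrite (le_trans _ (E1 _ _ (lexx _) t0 th))// -yh -zh.
have ds0 : derives (fun x => y0 x ^+ 2) (fun x => 2 * (y0 x * z0 x)).
  by apply: derives_eq; [derive_rules|move=> t /=; ring].
have ds1 : derives (fun x => y1 x ^+ 2) (fun x => 2 * (y1 x * z1 x)).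
  by apply: derives_eq; [derive_rules|move=> t /=; ring].
have [x0 xH] : 0 < x /\ x < H by move: xI; rewrite /= in_itv => /andP.
have [xh|hx] := leP x h0.
  have xI0 : 0 <= x <= h0 by rewrite xh ltW.
  have [_ ->] := u0E x xI0; apply/eqP; rewrite -sqrf_eq0.
  rewrite (derives_cst_itv (ltW x0) ds0) ?y00 ?expr0n// => t /andP[t0 tx].
  by rewrite Z0 ?mulr0// t0 (le_trans tx).
have xI1 : h0 <= x <= H by rewrite !ltW.
have [_ ->] := u1E x xI1; apply/eqP; rewrite -sqrf_eq0.
rewrite -(derives_cst_itv (ltW xH) ds1) ?y1H ?expr0n// => t /andP[t0 tx].
by rewrite Z1 ?mulr0// tx (le_trans _ t0)// ltW.
Qed.

(** Up to a nonzero factor, the Wronskian at the interface of the profile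
    [sin (mu x)] of the lower layer and [sinh (kappa (H - x))] of the upper. *)
Definition dispersion mu kappa :=
  kappa * sin (mu * h0) * cosh (kappa * (H - h0)) +
  mu * cos (mu * h0) * sinh (kappa * (H - h0)).

(** The profile is [sin] below and [sinh] above the interface; eliminating the
    two amplitudes from the matching conditions leaves the dispersion relation. *)
Lemma mode_explicit k lambda mu kappa u : 0 < mu -> 0 < kappa ->
  lambda = mu ^+ 2 + (k%:R * pi) ^+ 2 ->
  kappa ^+ 2 = (k%:R * pi) ^+ 2 - lambda / c1 ->
  transverse_mode H h0 c1 k lambda u ->
  dispersion mu kappa = 0 /\
  exists2 al, al <> 0 &
    (forall x, 0 <= x <= h0 -> u x = al * sin (mu * x)) /\
    (forall x, h0 <= x <= H -> u x =
       al * sin (mu * h0) / sinh (kappa * (H - h0)) * sinh (kappa * (H - x))).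
Proof.
move=> mu0 ka0 lamE kaE tm.
have [U [y0 [z0 [y1 [z1 [[dy0 dz0 dy1 dz1] u0E u1E yh zh]]]]]] :=
  mode_primitives h0_gt0 h0_ltH tm.
have [_ _ u0 uH [x xI ux]] := tm.
have q0E : - layer_q k lambda 1 = - mu ^+ 2 by rewrite /layer_q lamE; field.
have q1E : - layer_q k lambda c1 = kappa ^+ 2 by rewrite /layer_q kaE; ring.
rewrite q0E in dz0; rewrite q1E in dz1.
have U0 t : 0 <= t <= h0 -> U t = y0 t by move=> /u0E[<-].
have U1 t : h0 <= t <= H -> U t = y1 t by move=> /u1E[<-].
have y00 : y0 0 = 0 by have [] := u0E 0; rewrite ?lexx ?ltW// => _ <-.
have y1H : y1 H = 0 by have [] := u1E H; rewrite ?lexx ?ltW// => _ <-.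
have S0 := oscillator_solution mu0 (ltW h0_gt0) dy0 dz0 U0 y00.
have S1 := evanescent_solution (ltW h0_ltH) dy1 dz1 U1 y1H.
have hI0 : 0 <= h0 <= h0 by rewrite lexx ltW.
have hI1 : h0 <= h0 <= H by rewrite lexx ltW.
have L0 : 0 < H - h0 by rewrite subr_gt0.
have SL0 : 0 < sinh (kappa * (H - h0)) by rewrite sinh_gt0// mulr_gt0.
have [Y0 Z0] := S0 h0 hI0; have [Y1 Z1] := S1 h0 hI1.
rewrite yh in Y0; rewrite zh in Z0.
have u0x t : 0 <= t <= h0 -> u t = z0 0 / mu * sin (mu * t).
  move=> tI; have [_ ->] := u0E t tI; have [Yt _] := S0 t tI.
  by apply: (mulfI (lt0r_neq0 mu0)); rewrite Yt; field; rewrite gt_eqF.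
have match1 : - z1 H / kappa =
    z0 0 / mu * sin (mu * h0) / sinh (kappa * (H - h0)).
  have e : y1 h0 = z0 0 / mu * sin (mu * h0).
    by apply: (mulfI (lt0r_neq0 mu0)); rewrite Y0; field; rewrite gt_eqF.
  rewrite -e; apply: (mulfI (lt0r_neq0 ka0)).
  by rewrite [RHS]mulrA Y1; field; rewrite !gt_eqF.
have u1x t : h0 <= t <= H -> u t = z0 0 / mu * sin (mu * h0) /
    sinh (kappa * (H - h0)) * sinh (kappa * (H - t)).
  move=> tI; have [_ ->] := u1E t tI; have [Yt _] := S1 t tI.
  rewrite -match1; apply: (mulfI (lt0r_neq0 ka0)); rewrite Yt; field; rewrite gt_eqF//.
have z00 : z0 0 <> 0.
  move=> z00; apply: ux; move: xI; rewrite /= in_itv/= => /andP[x0 xH].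
  have [xh|hx] := leP x h0.
    by rewrite u0x ?z00 ?mul0r// xh ltW.
  by rewrite u1x ?z00 ?mul0r// !ltW.
split; last first.
  exists (z0 0 / mu) => //.
  by move=> /eqP; rewrite mulf_eq0 invr_eq0 (gt_eqF mu0) orbF => /eqP.
apply: (mulfI (introN eqP z00)); rewrite mulr0 /dispersion.
transitivity (kappa * cosh (kappa * (H - h0)) * (z0 0 * sin (mu * h0)) +
  mu * sinh (kappa * (H - h0)) * (z0 0 * cos (mu * h0))); first by ring.
rewrite -Y0 -Z0 Z1.
transitivity (mu * cosh (kappa * (H - h0)) * (kappa * y1 h0) +
  mu * sinh (kappa * (H - h0)) * (z1 H * cosh (kappa * (H - h0)))); first by ring.
by rewrite Y1; ring.
Qed.

End Modes.

(** * Modes from solutions of the dispersion relation *)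

Section Gluing.
Context {R : realType}.
Implicit Types (f g F G : R -> R).

Lemma continuous_glue F G (h0 : R) : continuous F -> continuous G -> F h0 = G h0 ->
  continuous (fun x => if x < h0 then F x else G x).
Proof.
move=> cF cG FG.
rewrite (_ : (fun x => _) =
    (fun x => F (Num.min x h0) + G (Num.max x h0) - F h0)); last first.
  apply/funext => x; have [xh|hx] := ltP x h0; first by rewrite FG; ring.
  by ring.
have cmin : continuous (fun x => F (Num.min x h0)).
  apply: (continuous_compf _ cF) => x.
  apply: (@continuous_min R R (fun x => x) (fun=> h0)); first exact: cvg_id.
  exact: cst_continuous.
have cmax : continuous (fun x => G (Num.max x h0)).
  apply: (continuous_compf _ cG) => x.
  apply: (@continuous_max R R (fun x => x) (fun=> h0)); first exact: cvg_id.
  exact: cst_continuous.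
by continuity_rules.
Qed.

Lemma L2_glue F G (H h0 : R) : continuous F -> continuous G ->
  L2 (leb1 R) `]0, H[ (fun x => if x < h0 then F x else G x).
Proof.
move=> cF cG; split; first exact: measurable_piecewise.
rewrite (_ : (fun x => _) =
  EFin \o (fun x => if x < h0 then F x ^+ 2 else G x ^+ 2)).
  by apply: integrable_piecewise; continuity_rules.
by apply/funext => x /=; case: ifP.
Qed.

Lemma test1_boundary (H : R) phi : test1 `]0, H[ phi -> phi 0 = 0 /\ phi H = 0.
Proof.
move=> [_ _ [K [_ KI K0]]].
by split; apply: K0 => /KI; rewrite /= in_itv/= ltxx ?andbF.
Qed.

(** Integration by parts in each layer; the boundary terms at [h0] cancel because
    the glued function is continuous there. *)
Lemma weak_derivative1_glue F G f g (H h0 : R) : 0 < h0 -> h0 < H ->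
  derives F f -> derives G g -> continuous f -> continuous g ->
  F h0 = G h0 ->
  weak_derivative1 `]0, H[ (fun x => if x < h0 then F x else G x)
                           (fun x => if x < h0 then f x else g x).
Proof.
move=> h00 hH dF dG cf cg FG phi tphi.
have [phi0 phiH] := test1_boundary tphi.
have [dphi cphi1 _] := tphi.
have dphi1 : derives phi (derive1 phi).
  by move=> x; apply: DeriveDef => //; rewrite derive1E.
have cphi := is_derive_continuous dphi1.
have cF := is_derive_continuous dF; have cG := is_derive_continuous dG.
apply/eqP; rewrite -addr_eq0; apply/eqP.
transitivity
  (\int[leb1 R]_(x in `]0, H[)
      (if x < h0 then F x * derive1 phi x else G x * derive1 phi x) +
   \int[leb1 R]_(x in `]0, H[)
      (if x < h0 then f x * phi x else g x * phi x)).
  by congr (_ + _); apply: eq_Rintegral => x _; case: ifP.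
rewrite integral_piecewise ?ltW//; [|by continuity_rules..].
rewrite integral_piecewise ?ltW//; [|by continuity_rules..].
rewrite addrACA -integralDf; [|by continuity_rules..].
rewrite -integralDf; [|by continuity_rules..].
have dFphi : derives (fun x => F x * phi x)
    (fun x => F x * derive1 phi x + f x * phi x).
  by apply: derives_eq; [derive_rules|].
have dGphi : derives (fun x => G x * phi x)
    (fun x => G x * derive1 phi x + g x * phi x).
  by apply: derives_eq; [derive_rules|].
rewrite (integral_derive (ltW h00) dFphi); last by continuity_rules.
rewrite (integral_derive (ltW hH) dGphi); last by continuity_rules.
by rewrite phi0 phiH FG; ring.
Qed.

End Gluing.

Section Converse.
Context {R : realType}.
Variables (H h0 c1 : R).
Hypotheses (h0_gt0 : 0 < h0) (h0_ltH : h0 < H) (c1_gt1 : 1 < c1).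

(** The dispersion relation is exactly the continuity at [h0] of the first
    derivative of the glued profile. *)
Lemma dispersion_mode k (lambda mu kappa : R) : 0 < mu -> 0 < kappa ->
  lambda = mu ^+ 2 + (k%:R * pi) ^+ 2 ->
  kappa ^+ 2 = (k%:R * pi) ^+ 2 - lambda / c1 ->
  dispersion H h0 mu kappa = 0 ->
  exists u, transverse_mode H h0 c1 k lambda u.
Proof.
move=> mu0 ka0 lamE kaE disp.
have L0 : 0 < H - h0 by rewrite subr_gt0.
have SL0 : 0 < sinh (kappa * (H - h0)) by rewrite sinh_gt0// mulr_gt0.
pose be := sin (mu * h0) / sinh (kappa * (H - h0)).
pose F x := sin (mu * x); pose G x := be * sinh (kappa * (H - x)).
pose f x := mu * cos (mu * x); pose g x : R := - be * kappa * cosh (kappa * (H - x)).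
pose f' x : R := - mu ^+ 2 * sin (mu * x).
pose g' x : R := be * kappa ^+ 2 * sinh (kappa * (H - x)).
have dF : derives F f.
  by rewrite /F /f; apply: derives_eq; [derive_rules|move=> x /=; ring].
have dG : derives G g.
  by rewrite /G /g; apply: derives_eq; [derive_rules|move=> x /=; ring].
have df : derives f f'.
  by rewrite /f' /f; apply: derives_eq; [derive_rules|move=> x /=; ring].
have dg : derives g g'.
  by rewrite /g' /g; apply: derives_eq; [derive_rules|move=> x /=; ring].
have cF := is_derive_continuous dF; have cG := is_derive_continuous dG.
have cf := is_derive_continuous df; have cg := is_derive_continuous dg.
have cf' : continuous f' by rewrite /f'; continuity_rules.
have cg' : continuous g' by rewrite /g'; continuity_rules.
have FG : F h0 = G h0 by rewrite /F /G /be mulfVK ?gt_eqF.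
have fg : f h0 = g h0.
  apply: (mulIf (lt0r_neq0 SL0)).
  rewrite /g /be; apply/eqP; rewrite -subr_eq0; apply/eqP.
  transitivity (dispersion H h0 mu kappa); last exact: disp.
  by rewrite /dispersion /f; field; rewrite gt_eqF.
exists (fun x => if x < h0 then F x else G x); split.
- by apply: continuous_subspaceT; exact: continuous_glue.
- exists (fun x => if x < h0 then f x else g x),
         (fun x => if x < h0 then f' x else g' x); split.
    split; first exact: L2_glue; first exact: L2_glue; first exact: L2_glue.
      exact: weak_derivative1_glue.
    exact: weak_derivative1_glue.
  apply: aeW => x _; rewrite /layer_c; case: ifP => _.
    by rewrite /f' /F divr1 lamE; ring.
  rewrite /g' /G kaE; ring.
- by rewrite h0_gt0 /F mulr0 sin0.
- by rewrite ltNge (ltW h0_ltH)/= /G subrr mulr0 sinh0 mulr0.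
pose x := Num.min h0 (pi / mu) / 2.
have p0 : 0 < pi / mu :> R by rewrite divr_gt0// pi_gt0.
have m0 : 0 < Num.min h0 (pi / mu) by rewrite lt_min h0_gt0 p0.
have xh : x < h0.
  rewrite /x ltr_pdivrMr// (@le_lt_trans _ _ h0)// ?ge_min ?lexx//.
  by rewrite ltr_pMr// ltr1n.
have x0 : 0 < x by rewrite divr_gt0.
exists x; first by rewrite /= in_itv/= x0 (lt_trans xh).
rewrite xh /F; apply/eqP; rewrite gt_eqF// sin_gt0_pi// mulr_gt0//=.
rewrite mulrC -ltr_pdivlMr// /x ltr_pdivrMr// (@le_lt_trans _ _ (pi / mu))//.
  by rewrite ge_min lexx orbT.
by rewrite ltr_pMr// ltr1n.
Qed.

End Converse.

(** * Solutions of the dispersion relation *)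

Section Branches.
Context {R : realType}.
Implicit Types (t r : R) (n : nat).

Lemma natS_pi n : n.+1%:R * pi = n%:R * pi + pi :> R.
Proof. by rewrite -[n.+1%:R]natr1; ring. Qed.

Lemma sin_shift n r : sin (n%:R * pi + r) = (-1) ^+ n * sin r :> R.
Proof.
elim: n => [|n IH]; first by rewrite mul0r add0r expr0 mul1r.
rewrite (_ : n.+1%:R * pi + r = (n%:R * pi + r) + pi); last first.
  by rewrite natS_pi; ring.
by rewrite sinDpi IH exprS; ring.
Qed.

Lemma cos_shift n r : cos (n%:R * pi + r) = (-1) ^+ n * cos r :> R.
Proof.
elim: n => [|n IH]; first by rewrite mul0r add0r expr0 mul1r.
rewrite (_ : n.+1%:R * pi + r = (n%:R * pi + r) + pi); last first.
  by rewrite natS_pi; ring.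
by rewrite cosDpi IH exprS; ring.
Qed.

Lemma signr_sqr n : (-1) ^+ n * (-1) ^+ n = 1 :> R.
Proof. by rewrite -expr2 sqrr_sign. Qed.

(** The intervals of the positive half-line on which [tan] is negative. *)
Definition branch n t := n%:R * pi + pi / 2 < t < n.+1%:R * pi.

Lemma branchP t : 0 <= t -> sin t * cos t < 0 -> exists n, branch n t.
Proof.
move=> t0 sc; have p0 : 0 < pi :> R := pi_gt0 R.
pose n := Num.truncn (t / pi).
have /andP[nt tn] : n%:R <= t / pi < n.+1%:R.
  by apply: truncn_itv; rewrite divr_ge0// ltW.
rewrite ler_pdivlMr// in nt; rewrite ltr_pdivrMr// in tn.
exists n; rewrite /branch tn andbT ltNge; apply/negP => tle.
pose r := t - n%:R * pi.
have tE : t = n%:R * pi + r by rewrite /r; ring.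
move: sc; rewrite tE sin_shift cos_shift mulrACA signr_sqr mul1r.
apply/negP; rewrite -leNgt mulr_ge0//.
  rewrite sin_ge0_pi// /r subr_ge0 nt/= lerBlDr; move: tn.
  by rewrite natS_pi addrC => /ltW.
rewrite cos_ge0_pihalf// /r; apply/andP; split.
  by rewrite (@le_trans _ _ 0) ?subr_ge0// oppr_le0 divr_ge0// ltW.
by rewrite lerBlDl.
Qed.

Lemma branch_lt n m t1 t2 : (n < m)%N -> branch n t1 -> branch m t2 -> t1 < t2.
Proof.
move=> nm /andP[_ t1n] /andP[mt2 _]; rewrite (lt_trans t1n)// (le_lt_trans _ mt2)//.
rewrite -[X in X <= _]addr0 lerD//; last by rewrite divr_ge0// ltW// pi_gt0.
by rewrite ler_wpM2r ?ler_nat// ltW// pi_gt0.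
Qed.

Lemma branch_leq n m t1 t2 : t1 <= t2 -> branch n t1 -> branch m t2 -> (n <= m)%N.
Proof.
move=> t12 b1 b2; rewrite leqNgt; apply/negP => mn.
by have := branch_lt mn b2 b1; rewrite ltNge t12.
Qed.

Lemma branch_cos n t : branch n t -> 0 < (-1) ^+ n.+1 * cos t.
Proof.
move=> /andP[t1 t2].
have -> : t = n.+1%:R * pi + (t - n.+1%:R * pi) by ring.
rewrite cos_shift mulrA signr_sqr mul1r cos_gt0_pihalf//.
have p0 : 0 < pi :> R := pi_gt0 R.
by move: t1 t2; rewrite natS_pi => t1 t2; apply/andP; split; lra.
Qed.

End Branches.

Section Dispersion.
Context {R : realType}.
Variables (H h0 : R).
Hypotheses (h0_gt0 : 0 < h0) (h0_ltH : h0 < H).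
Implicit Types (mu kappa : R).

Let L_gt0 : 0 < H - h0. Proof. by rewrite subr_gt0. Qed.

(** The dispersion relation forces [sin] and [cos] of [mu * h0] to have opposite
    signs. *)
Lemma dispersion_branch mu kappa : 0 < mu -> 0 < kappa ->
  dispersion H h0 mu kappa = 0 -> exists n, branch n (mu * h0).
Proof.
move=> mu0 ka0; rewrite /dispersion => disp.
have S0 : 0 < sinh (kappa * (H - h0)) by rewrite sinh_gt0// mulr_gt0.
have C0 := cosh_gt0 (kappa * (H - h0)).
apply: branchP; first by rewrite mulr_ge0// ltW.
set s := sin _ in disp *; set c := cos _ in disp *.
have KC : 0 < kappa * cosh (kappa * (H - h0)) by rewrite mulr_gt0.
have MS : 0 < mu * sinh (kappa * (H - h0)) by rewrite mulr_gt0.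
have sE : (kappa * cosh (kappa * (H - h0))) * s = - (mu * sinh (kappa * (H - h0))) * c.
  by apply/eqP; rewrite -subr_eq0 -disp; apply/eqP; ring.
have c0 : c != 0.
  apply/eqP => c0; move: sE; rewrite c0 mulr0 => /eqP; rewrite mulf_eq0 gt_eqF//= => /eqP s0.
  by have := cos2Dsin2 (mu * h0); rewrite -/c -/s c0 s0 expr0n addr0 => /eqP; rewrite eq_sym oner_eq0.
rewrite -(pmulr_rlt0 _ KC) mulrA sE -mulrA -expr2 mulNr oppr_lt0 mulr_gt0//.
by rewrite exprn_even_gt0.
Qed.

(** On a branch [tan (mu h0)] increases with [mu], while
    [- mu tanh (kappa L) / kappa] decreases when [mu] increases and [kappa]
    decreases.  The comparison is carried out with denominators cleared, for
    [sin (mu2 h0 - mu1 h0)]. *)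
Lemma dispersion_uniq mu1 mu2 kappa1 kappa2 n :
  0 < mu1 -> mu1 < mu2 -> 0 < kappa2 -> kappa2 < kappa1 ->
  dispersion H h0 mu1 kappa1 = 0 -> dispersion H h0 mu2 kappa2 = 0 ->
  branch n (mu1 * h0) -> branch n (mu2 * h0) -> False.
Proof.
move=> m10 m12 k20 k21 d1 d2 b1 b2.
have k10 := lt_trans k20 k21.
have p0 : 0 < pi :> R := pi_gt0 R.
have S1 : 0 < sinh (kappa1 * (H - h0)) by rewrite sinh_gt0// mulr_gt0.
have S2 : 0 < sinh (kappa2 * (H - h0)) by rewrite sinh_gt0// mulr_gt0.
have C1 := cosh_gt0 (kappa1 * (H - h0)).
have C2 := cosh_gt0 (kappa2 * (H - h0)).
have cc : 0 < cos (mu1 * h0) * cos (mu2 * h0).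
  have := mulr_gt0 (branch_cos b1) (branch_cos b2).
  by rewrite mulrACA signr_sqr mul1r.
have s21 : 0 < sin (mu2 * h0 - mu1 * h0).
  have lt12 : mu1 * h0 < mu2 * h0 by rewrite ltr_pM2r.
  move: b1 b2; rewrite /branch natS_pi => /andP[b1 _] /andP[_ b2].
  by apply: sin_gt0_pi; apply/andP; split; lra.
have T := tanh_ratio (ltW (mulr_gt0 k20 L_gt0)) (ltW (_ : kappa2 * (H - h0) < kappa1 * (H - h0))).
have {T} := T _; rewrite ltr_pM2r// => /(_ k21) T.
have {}T : kappa2 * (sinh (kappa1 * (H - h0)) * cosh (kappa2 * (H - h0))) <=
           kappa1 * (sinh (kappa2 * (H - h0)) * cosh (kappa1 * (H - h0))).
  have e p x : (H - h0) * (p * x) = p * (H - h0) * x by ring.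
  by rewrite -(ler_pM2l L_gt0) !e.
move: d1 d2 s21; rewrite /dispersion sinB.
move: S1 S2 C1 C2 T cc.
set s1 := sin (mu1 * _); set c1 := cos (mu1 * _).
set s2 := sin (mu2 * _); set c2 := cos (mu2 * _).
move: (sinh (kappa1 * _)) (cosh (kappa1 * _)) (sinh (kappa2 * _)) (cosh (kappa2 * _)).
move=> A1 B1 A2 B2 A10 A20 B10 B20 T cc d1 d2 s21.
have e1 : kappa1 * B1 * s1 = - (mu1 * A1 * c1).
  by apply/eqP; rewrite -subr_eq0 -d1; apply/eqP; ring.
have e2 : kappa2 * B2 * s2 = - (mu2 * A2 * c2).
  by apply/eqP; rewrite -subr_eq0 -d2; apply/eqP; ring.
have pos : 0 < kappa1 * B1 * (kappa2 * B2) * (s2 * c1 - c2 * s1).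
  by rewrite mulr_gt0// !mulr_gt0.
have E : kappa1 * B1 * (kappa2 * B2) * (s2 * c1 - c2 * s1) =
   c1 * c2 * (mu1 * (kappa2 * (A1 * B2)) - mu2 * (kappa1 * (A2 * B1))).
  transitivity (kappa1 * B1 * c1 * (kappa2 * B2 * s2) - kappa2 * B2 * c2 * (kappa1 * B1 * s1)).
    by ring.
  by rewrite e1 e2; ring.
move: pos; rewrite E (pmulr_rgt0 _ cc) subr_gt0; apply/negP; rewrite -leNgt.
apply: ler_pM => //; [exact: ltW| |exact: ltW].
by rewrite !mulr_ge0// ltW.
Qed.

(** Intermediate value theorem: the dispersion function has opposite signs at the
    two ends of the branch, where [cos], respectively [sin], vanishes.  The
    hypotheses on [mustar] keep [kappa] real on the whole branch. *)
Lemma dispersion_exists c1 K mustar n : 1 < c1 -> 0 <= mustar ->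
  mustar ^+ 2 < (c1 - 1) * K -> n.+1%:R * pi <= mustar * h0 ->
  exists mu kappa, [/\ 0 < mu, 0 < kappa, kappa ^+ 2 = ((c1 - 1) * K - mu ^+ 2) / c1,
     dispersion H h0 mu kappa = 0 & branch n (mu * h0)].
Proof.
move=> c11 ms0 msK nms.
have p0 : 0 < pi :> R := pi_gt0 R.
have c10 : 0 < c1 by exact: lt_trans ltr01 c11.
pose a := (n%:R * pi + pi / 2) / h0; pose b := (n.+1%:R * pi) / h0.
have ah : a * h0 = n%:R * pi + pi / 2 by rewrite /a mulfVK ?gt_eqF.
have bh : b * h0 = n.+1%:R * pi by rewrite /b mulfVK ?gt_eqF.
have bE : b * h0 = n%:R * pi + pi by rewrite bh natS_pi.
have a0 : 0 < a by rewrite divr_gt0// ltr_wpDl ?divr_gt0// mulr_ge0// ltW.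
have ab : a < b by rewrite -(ltr_pM2r h0_gt0) ah bE; lra.
have bms : b <= mustar by rewrite -(ler_pM2r h0_gt0) bh.
pose ka (mu : R) : R := Num.sqrt (((c1 - 1) * K - mu ^+ 2) / c1).
have arg0 mu : 0 <= mu -> mu <= b -> 0 < ((c1 - 1) * K - mu ^+ 2) / c1.
  move=> mu0 mub; rewrite divr_gt0// subr_gt0 (le_lt_trans _ msK)//.
  by rewrite ler_pXn2r ?nnegrE// (le_trans mub).
have ka0 mu : 0 <= mu -> mu <= b -> 0 < ka mu by move=> mu0 mub; rewrite sqrtr_gt0 arg0.
have cka : continuous ka.
  rewrite /ka; apply: (@continuous_compf _ (fun mu => ((c1 - 1) * K - mu ^+ 2) / c1) Num.sqrt).
    by continuity_rules.
  exact: sqrt_continuous.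
pose F (mu : R) : R := (-1) ^+ n * dispersion H h0 mu (ka mu).
have cF : continuous F by rewrite /F /dispersion; continuity_rules.
have Fa : 0 < F a.
  rewrite /F /dispersion ah sin_shift cos_shift sin_pihalf cos_pihalf.
  have -> : forall x y z : R, (-1) ^+ n * (x * ((-1) ^+ n * 1) * y + a * ((-1) ^+ n * 0) * z)
     = (-1) ^+ n * (-1) ^+ n * (x * y) by move=> x y z; ring.
  by rewrite signr_sqr mul1r mulr_gt0 ?cosh_gt0// ka0// ltW.
have Fb : F b < 0.
  rewrite /F /dispersion bE sin_shift cos_shift sinpi cospi.
  have -> : forall x y z : R, (-1) ^+ n * (x * ((-1) ^+ n * 0) * y + b * ((-1) ^+ n * -1) * z)
     = - ((-1) ^+ n * (-1) ^+ n * (b * z)) by move=> x y z; ring.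
  rewrite signr_sqr mul1r oppr_lt0; have b0 := lt_trans a0 ab.
  by rewrite mulr_gt0// sinh_gt0// mulr_gt0// ka0// ltW.
have cFab : {within `[a, b], continuous F} by exact: continuous_subspaceT.
have [|mu] := @IVT _ F a b 0 (ltW ab) cFab.
  by rewrite ge_min le_max (ltW Fa) (ltW Fb) orbT.
rewrite in_itv/= => /andP[amu mub] Fmu.
have amu' : a < mu by rewrite lt_neqAle amu andbT; apply/eqP => e; move: Fa; rewrite e Fmu ltxx.
have mub' : mu < b by rewrite lt_neqAle mub andbT; apply/eqP => e; move: Fb; rewrite -e Fmu ltxx.
have mu0 := lt_trans a0 amu'.
exists mu, (ka mu); split => //.
- by apply: ka0 => //; exact: ltW.
- by rewrite sqr_sqrtr// ltW// arg0// ltW.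
- by have /eqP := Fmu; rewrite mulf_eq0 signr_eq0/= => /eqP.
- by rewrite /branch -ah -bh !ltr_pM2r// amu' mub'.
Qed.

End Dispersion.

(** * Numbering of the eigenvalues *)

Section Counting.
Context {R : realType}.
Variables (H h0 c1 : R).
Hypotheses (h0_gt0 : 0 < h0) (h0_ltH : h0 < H) (c1_gt1 : 1 < c1).
Implicit Types (mu kappa lambda : R).

Lemma guided_parameters k lambda :
  (k%:R * pi) ^+ 2 < lambda < c1 * (k%:R * pi) ^+ 2 ->
  let mu := Num.sqrt (lambda - (k%:R * pi) ^+ 2) in
  let kappa := Num.sqrt ((k%:R * pi) ^+ 2 - lambda / c1) in
  [/\ 0 < mu, 0 < kappa, lambda = mu ^+ 2 + (k%:R * pi) ^+ 2 &
      kappa ^+ 2 = (k%:R * pi) ^+ 2 - lambda / c1].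
Proof.
move=> /andP[Kl lK].
have c10 : 0 < c1 by exact: lt_trans ltr01 c1_gt1.
have ka0 : 0 < (k%:R * pi) ^+ 2 - lambda / c1.
  by rewrite subr_gt0 ltr_pdivrMr// mulrC.
split.
- by rewrite sqrtr_gt0 subr_gt0.
- by rewrite sqrtr_gt0.
- by rewrite sqr_sqrtr ?subrK// subr_ge0 ltW.
- by rewrite sqr_sqrtr// ltW.
Qed.

(** By induction on [l].  By uniqueness on branches the [l]-th eigenvalue lies on
    a later branch than the previous one; it cannot skip branch [l.-1], since
    the solution existing there would be an eigenvalue smaller than the [l]-th
    one and on none of the branches of the previous ones. *)
Lemma spectrum_branch (lam : nat -> nat -> R) k l :
  transverse_spectrum H h0 c1 lam -> (0 < k)%N -> (0 < l)%N ->
  lam k l < c1 * (k%:R * pi) ^+ 2 ->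
  forall mu kappa, 0 < mu -> 0 < kappa ->
    lam k l = mu ^+ 2 + (k%:R * pi) ^+ 2 ->
    kappa ^+ 2 = (k%:R * pi) ^+ 2 - lam k l / c1 ->
  branch l.-1 (mu * h0).
Proof.
move=> lamP k0; have [mono specE] := lamP k k0.
set K := (k%:R * pi) ^+ 2.
have c10 : 0 < c1 by exact: lt_trans ltr01 c1_gt1.
have kaE mu lambda : lambda = mu ^+ 2 + K -> K - lambda / c1 = ((c1 - 1) * K - mu ^+ 2) / c1.
  by move=> ->; field; rewrite gt_eqF.
elim/ltn_ind: l => l IH l0 lK mu kappa mu0 ka0 lE ka2.
have modeP m : (0 < m)%N -> exists u, transverse_mode H h0 c1 k (lam k m) u.
  move=> m0; have : [set lam k l | l in [set l : nat | (0 < l)%N]] (lam k m) by exists m.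
  by rewrite specE.
have [u tm] := modeP l l0.
have [disp _] := mode_explicit h0_gt0 h0_ltH mu0 ka0 lE ka2 tm.
have [n bn] := dispersion_branch h0_gt0 h0_ltH mu0 ka0 disp.
suff -> : l.-1 = n by [].
have n_ge : (l.-1 <= n)%N.
  case: (ltnP 1 l) => [l1|]; last first.
    by case: l l0 {IH lK lE ka2 modeP tm} => [|[]].
  have m0 : (0 < l.-1)%N by rewrite -ltnS prednK.
  have ml : (l.-1 < l)%N by rewrite prednK.
  have lam_ml : lam k l.-1 < lam k l := mono _ _ m0 ml.
  have [u' tm'] := modeP _ m0.
  have Km := mode_lower_bound h0_gt0 h0_ltH c1_gt1 tm'.
  have lKm := lt_trans lam_ml lK.
  have /guided_parameters : K < lam k l.-1 < c1 * K by rewrite Km.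
  set mu' := Num.sqrt _; set ka' := Num.sqrt _.
  move=> [mu'0 ka'0 lE' ka2'].
  have [disp' _] := mode_explicit h0_gt0 h0_ltH mu'0 ka'0 lE' ka2' tm'.
  have bm := IH _ ml m0 lKm _ _ mu'0 ka'0 lE' ka2'.
  have mulu : mu' < mu.
    rewrite -(@ltr_pXn2r _ 2)// ?nnegrE ?ltW// -(ltrD2r ((k%:R * pi) ^+ 2)).
    by rewrite -lE' -lE.
  have kaka : kappa < ka'.
    rewrite -(@ltr_pXn2r _ 2)// ?nnegrE ?ltW// ka2 ka2'.
    by rewrite ltrD2l ltrN2 ltr_pM2r ?invr_gt0.
  have mun : mu' * h0 <= mu * h0 by rewrite ler_pM2r// ltW.
  have := branch_leq mun bm bn.
  rewrite leq_eqVlt => /predU1P[e|]; last by rewrite prednK.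
  exfalso; rewrite -e in bn.
  exact: (dispersion_uniq h0_gt0 h0_ltH mu'0 mulu ka0 kaka disp' disp bm bn).
have n_le : (n <= l.-1)%N.
  rewrite leqNgt; apply/negP => ln.
  have msK : mu ^+ 2 < (c1 - 1) * K.
    by move: lK; rewrite lE -ltrBrDr mulrBl mul1r.
  have lnpi : l.-1.+1%:R * pi <= mu * h0.
    move: bn => /andP[bn _]; rewrite (le_trans _ (ltW bn))//.
    rewrite -[X in X <= _]addr0 lerD//; last by rewrite divr_ge0// pi_ge0.
    by rewrite ler_wpM2r ?pi_ge0// ler_nat.
  have [mu' [ka' [mu'0 ka'0 ka2' disp' b']]] :=
    dispersion_exists h0_gt0 h0_ltH c1_gt1 (ltW mu0) msK lnpi.
  rewrite -(kaE mu' _ erefl) in ka2'.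
  have [u' tm'] := dispersion_mode h0_gt0 h0_ltH mu'0 ka'0 erefl ka2' disp'.
  have : [set lambda | exists u, transverse_mode H h0 c1 k lambda u] (mu' ^+ 2 + K).
    by exists u'.
  rewrite -specE => -[m m0 lamm].
  have mulu : mu' < mu.
    by rewrite -(ltr_pM2r h0_gt0); exact: branch_lt ln b' bn.
  have lamlt : lam k m < lam k l.
    by rewrite lamm lE ltrD2r ltr_pXn2r// nnegrE ltW.
  have ml : (m < l)%N.
    rewrite ltnNge leq_eqVlt; apply/negP => /predU1P[e|lm].
      by move: lamlt; rewrite e ltxx.
    by have := lt_trans lamlt (mono _ _ l0 lm); rewrite ltxx.
  have bm : branch m.-1 (mu' * h0).
    apply: (IH m ml m0 (lt_trans lamlt lK) mu' ka' mu'0 ka'0) => //.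
    by rewrite lamm.
  have ml1 : (m.-1 < l.-1)%N by move: ml m0 l0; case: (m) => // m'; case: (l).
  by have := branch_lt ml1 bm b'; rewrite ltxx.
by apply/eqP; rewrite eqn_leq n_ge.
Qed.

End Counting.

(** * The Riemann-Lebesgue lemma *)

Section RiemannLebesgue.
Context {R : realType}.
Implicit Types (n m : nat).

Let cs n (x : R) : R := cos (n%:R * (2 * pi) * x).

Let ccs n : continuous (cs n).
Proof. by rewrite /cs; continuity_rules. Qed.

Lemma integral_cos n : (0 < n)%N -> \int[leb1 R]_(x in `]0, 1[) cs n x = 0.
Proof.
move=> n0.
have p0 : n%:R * (2 * pi) != 0 :> R.
  by rewrite !mulf_neq0// ?pnatr_eq0 -?lt0n// gt_eqF// pi_gt0.
have d : derives (fun x => sin (n%:R * (2 * pi) * x) / (n%:R * (2 * pi))) (cs n).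
  apply: derives_eq; first by derive_rules.
  by move=> x /=; rewrite /cs mulr0 add0r mul0r addr0 mulr1 mulfK.
rewrite (integral_derive ler01 d)// mulr1 mulr0 sin0 mul0r subr0.
rewrite (_ : n%:R * (2 * pi) = (n * 2)%:R * pi + 0); last by rewrite natrM; ring.
by rewrite sin_shift sin0 mulr0 mul0r.
Qed.

Lemma cos_mul n m (x : R) : (n <= m)%N ->
  cs n x * cs m x = 1 / 2 * cs (m - n) x + 1 / 2 * cs (m + n) x.
Proof.
move=> nm; rewrite /cs natrB// natrD.
rewrite (_ : (m%:R - n%:R) * (2 * pi) * x =
  m%:R * (2 * pi) * x - n%:R * (2 * pi) * x); last by ring.
rewrite (_ : (m%:R + n%:R) * (2 * pi) * x =
  m%:R * (2 * pi) * x + n%:R * (2 * pi) * x); last by ring.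
by rewrite cosB cosD; field.
Qed.

Lemma integral_cos_mul n m : (0 < n)%N -> (n < m)%N ->
  \int[leb1 R]_(x in `]0, 1[) (cs n x * cs m x) = 0.
Proof.
move=> n0 nm.
rewrite (_ : (fun x => _) = fun x => 1 / 2 * cs (m - n) x + 1 / 2 * cs (m + n) x).
  rewrite integralDf; [|by continuity_rules..].
  rewrite integralZf; [|by continuity_rules].
  rewrite integralZf; [|by continuity_rules].
  by rewrite !integral_cos ?mulr0 ?addr0 ?subn_gt0// addn_gt0 n0 orbT.
by apply/funext => x; rewrite cos_mul// ltnW.
Qed.

Lemma integral_cos_sqr n : (0 < n)%N ->
  \int[leb1 R]_(x in `]0, 1[) (cs n x * cs n x) = 1 / 2.
Proof.
move=> n0.
rewrite (_ : (fun x => _) = fun x => 1 / 2 + 1 / 2 * cs (n + n) x).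
  rewrite integralDf; [|by continuity_rules..].
  rewrite [X in _ + X]integralZf; [|by continuity_rules].
  rewrite integral_cos ?addn_gt0 ?n0// mulr0 addr0.
  have d : derives (fun x : R => 1 / 2 * x) (fun=> 1 / 2).
    by apply: derives_eq; [derive_rules|move=> x /=; ring].
  rewrite (integral_derive ler01 d) ?mulr1 ?mulr0 ?subr0//.
  by continuity_rules.
apply/funext => x; rewrite cos_mul// subnn; congr (_ + _).
by rewrite /cs !mul0r cos0 mulr1.
Qed.

Section Bessel.
Variable A : set R.
Hypotheses (mA : measurable A) (A01 : A `<=` `]0, 1[).

Lemma integrable_sub f : continuous f -> (leb1 R).-integrable A (EFin \o f).
Proof.
move=> cf; exact: (@integrableS _ _ _ (leb1 R) `]0, 1[ A _
  (measurable_itv _) mA A01 (integrable_itvoo 0 1 cf)).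
Qed.

Let c n := \int[leb1 R]_(x in A) cs n x.
(** The [N]-th partial sum of the cosine series of the indicator function of [A],
    without its constant term. *)
Fixpoint bessel_sum N (x : R) : R :=
  if N is N'.+1 then bessel_sum N' x + 2 * c N * cs N x else 0.

Lemma continuous_bessel_sum N : continuous (bessel_sum N).
Proof.
by elim: N => [|N IH] /=; continuity_rules.
Qed.

Let sq N := \sum_(i < N) c i.+1 ^+ 2.

Lemma integral_bessel_sum N : \int[leb1 R]_(x in A) bessel_sum N x = 2 * sq N.
Proof.
have cS := @continuous_bessel_sum; rewrite /sq.
elim: N => [|N IH].
  by rewrite big_ord0 mulr0 /= /Rintegral integral0.
have cSN := cS N.
rewrite big_ord_recr /= RintegralD//; [|by apply: integrable_sub; continuity_rules..].
rewrite IH RintegralZl//; last exact: integrable_sub.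
by rewrite -/(c _); ring.
Qed.

Lemma bessel_sum_orthogonal N m : (N < m)%N ->
  \int[leb1 R]_(x in `]0, 1[) (bessel_sum N x * cs m x) = 0.
Proof.
have cS := @continuous_bessel_sum.
elim: N => [|N IH] Nm.
  under eq_Rintegral do rewrite mul0r; by rewrite /Rintegral integral0.
rewrite (_ : (fun x => _) = fun x => bessel_sum N x * cs m x + 2 * c N.+1 * (cs N.+1 x * cs m x)).
  have cSN := cS N.
  rewrite integralDf; [|by continuity_rules..].
  rewrite integralZf; [|by continuity_rules].
  by rewrite IH ?integral_cos_mul ?mulr0 ?addr0// ltnW.
by apply/funext => x /=; ring.
Qed.

Lemma integral_bessel_sum_sqr N :
  \int[leb1 R]_(x in `]0, 1[) (bessel_sum N x * bessel_sum N x) = 2 * sq N.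
Proof.
have cS := @continuous_bessel_sum; rewrite /sq.
elim: N => [|N IH].
  by rewrite big_ord0 mulr0 /=; under eq_Rintegral do rewrite mul0r; rewrite /Rintegral integral0.
rewrite (_ : (fun x => _) = fun x => bessel_sum N x * bessel_sum N x +
   (4 * c N.+1 * (bessel_sum N x * cs N.+1 x) +
    4 * c N.+1 ^+ 2 * (cs N.+1 x * cs N.+1 x))).
  have cSN := cS N.
  rewrite integralDf; [|by continuity_rules..].
  rewrite integralDf; [|by continuity_rules..].
  rewrite integralZf; [|by continuity_rules].
  rewrite integralZf; [|by continuity_rules].
  by rewrite IH bessel_sum_orthogonal// integral_cos_sqr// big_ord_recr /=; field.
by apply/funext => x /=; ring.
Qed.

(** Expand the integral over [A] of [(1 - bessel_sum N)^2 >= 0] and bound the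
    integral of [bessel_sum N ^ 2] over [A] by the one over the unit interval. *)
Lemma bessel N : 2 * sq N <= fine (leb1 R A).
Proof.
have cSN := @continuous_bessel_sum N.
have h1 : \int[leb1 R]_(x in A) (bessel_sum N x * bessel_sum N x) <= 2 * sq N.
  rewrite -integral_bessel_sum_sqr.
  rewrite [leLHS]Rintegral_mkcond [leRHS]Rintegral_mkcond.
  have cS2 : continuous (fun x => bessel_sum N x * bessel_sum N x).
    by continuity_rules.
  have iA : (leb1 R).-integrable A (EFin \o (fun x => bessel_sum N x * bessel_sum N x)).
    exact: integrable_sub.
  have iI := integrable_itvoo 0 1 cS2.
  have /integrable_mkcond := iA => /(_ mA) {}iA.
  have /integrable_mkcond := iI => /(_ (measurable_itv _)) {}iI.
  rewrite !restrict_EFin in iA iI.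
  apply: le_Rintegral => //.
  move=> x _; rewrite !patchE; case: ifPn => xA.
    by rewrite mem_set//; apply: A01; exact: set_mem.
  by case: ifP => //; rewrite -expr2 sqr_ge0.
have h2 : 0 <= \int[leb1 R]_(x in A) (1 + (-2 * bessel_sum N x + bessel_sum N x * bessel_sum N x)).
  apply: Rintegral_ge0 => x _.
  rewrite (_ : _ + _ = (1 - bessel_sum N x) ^+ 2) ?sqr_ge0//; ring.
move: h2; rewrite RintegralD//; last 2 first.
- by apply: integrable_sub; continuity_rules.
- by apply: integrable_sub; continuity_rules.
rewrite RintegralD//; last 2 first.
- by apply: integrable_sub; continuity_rules.
- by apply: integrable_sub; continuity_rules.
rewrite RintegralZl//; last by apply: integrable_sub; continuity_rules.
rewrite integral_bessel_sum Rintegral_cst// mul1r.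
lra.
Qed.

(** The squares of these coefficients form a convergent series by [bessel]. *)
Lemma cvg_cos_integral : \int[leb1 R]_(x in A) cs n x @[n --> \oo] --> (0 : R).
Proof.
have S : series (fun n => c n.+1 ^+ 2) = sq.
  by apply/funext => N; rewrite /series /= big_mkord.
have cv : cvgn (series (fun n => c n.+1 ^+ 2)).
  apply: nondecreasing_is_cvgn.
    by apply/nondecreasing_seqP => n; rewrite S /sq big_ord_recr/= lerDl sqr_ge0.
  exists (fine (leb1 R A) / 2) => _ [n _ <-].
  by rewrite S ler_pdivlMr// mulrC bessel.
have c2 := cvg_series_cvg_0 cv.
rewrite -(cvg_shiftS c); apply/norm_cvg0P.
rewrite (_ : (fun n => _) = fun n => Num.sqrt (c n.+1 ^+ 2)); last first.
  by apply/funext => n; rewrite sqrtr_sqr.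
by have := continuous_cvg _ (@sqrt_continuous R 0) c2; rewrite sqrtr0; apply.
Qed.

Lemma cvg_sin_sqr_integral :
  \int[leb1 R]_(x in A) (sin (n%:R * pi * x) ^+ 2) @[n --> \oo] -->
  fine (leb1 R A) / 2.
Proof.
rewrite (_ : (fun n => _) = fun n => fine (leb1 R A) / 2 + - (1 / 2) * c n).
  rewrite -[X in _ --> X]addr0 -[X in _ + X](mulr0 (- (1 / 2))).
  by apply: cvgD; [exact: cvg_cst|apply: cvgMr; exact: cvg_cos_integral].
apply/funext => n.
transitivity (\int[leb1 R]_(x in A) (1 / 2 + - (1 / 2) * cs n x)).
  apply: eq_Rintegral => x _; rewrite /cs.
  rewrite (_ : n%:R * (2 * pi) * x = (n%:R * pi * x) *+ 2); last by rewrite -mulr_natr; ring.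
  by rewrite cos_mulr2n sin2cos2; field.
have ccn := @ccs n.
rewrite RintegralD//; last 2 first.
- by apply: integrable_sub; continuity_rules.
- by apply: integrable_sub; continuity_rules.
rewrite [X in _ + X]RintegralZl//; last by apply: integrable_sub; continuity_rules.
by rewrite Rintegral_cst// -/(c n); ring.
Qed.

End Bessel.

Lemma integral_sin_sqr_unit n : (0 < n)%N ->
  \int[leb1 R]_(x in `]0, 1[) (sin (n%:R * pi * x) ^+ 2) = 1 / 2.
Proof.
move=> n0.
rewrite (_ : (fun x => _) = fun x => 1 / 2 + - (1 / 2) * cs n x).
  rewrite integralDf; [|by continuity_rules..].
  rewrite [X in _ + X]integralZf; [|by continuity_rules].
  rewrite integral_cos// mulr0 addr0.
  have d : derives (fun x : R => 1 / 2 * x) (fun=> 1 / 2).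
    by apply: derives_eq; [derive_rules|move=> x /=; ring].
  rewrite (integral_derive ler01 d) ?mulr1 ?mulr0 ?subr0//.
  by continuity_rules.
apply/funext => x; rewrite /cs.
rewrite (_ : n%:R * (2 * pi) * x = (n%:R * pi * x) *+ 2); last by rewrite -mulr_natr; ring.
by rewrite cos_mulr2n sin2cos2; field.
Qed.

End RiemannLebesgue.

(** * Norms of separated functions *)

Section Product.
Context {R : realType}.

Lemma sqnorm_product (A B : set (measurableTypeR R)) (f g : R -> R) (C : R) (v : R * R -> R) :
  measurable A -> measurable B -> continuous f -> continuous g ->
  (leb1 R).-integrable A (EFin \o (fun x => f x ^+ 2)) ->
  (leb1 R).-integrable B (EFin \o (fun x => g x ^+ 2)) ->
  (forall z, (A `*` B) z -> v z = C * f z.1 * g z.2) ->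
  sqnorm (leb2 R) (A `*` B) v =
  C ^+ 2 * (\int[leb1 R]_(x in A) (f x ^+ 2)) *
           (\int[leb1 R]_(x in B) (g x ^+ 2)).
Proof.
move=> mA mB cf cg iA iB vE; rewrite /sqnorm.
pose F := (fun x => C ^+ 2 * f x ^+ 2) \_ A.
pose G := (fun x => g x ^+ 2) \_ B.
have cF2 : continuous (fun x => C ^+ 2 * f x ^+ 2) by continuity_rules.
have cG2 : continuous (fun x => g x ^+ 2) by continuity_rules.
have F0 x : 0 <= F x.
  by rewrite /F patchE; case: ifP => // _; rewrite mulr_ge0// sqr_ge0.
have G0 x : 0 <= G x by rewrite /G patchE; case: ifP => // _; rewrite sqr_ge0.
have mF : measurable_fun (T := measurableTypeR R) setT F.
  apply/(measurable_restrictT _ mA).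
  by apply: measurable_funTS; exact: continuous_measurable_fun.
have mG : measurable_fun (T := measurableTypeR R) setT G.
  apply/(measurable_restrictT _ mB).
  by apply: measurable_funTS; exact: continuous_measurable_fun.
have -> : \int[leb2 R]_(z in A `*` B) (v z ^+ 2) =
          \int[leb2 R]_z (F z.1 * G z.2).
  rewrite Rintegral_mkcond; apply: eq_Rintegral => -[x y] _.
  rewrite !patchE /F /G /= !patchE in_setX.
  case: (boolP (x \in A)) => xA /=; last by rewrite mul0r.
  case: (boolP (y \in B)) => yB /=; last by rewrite mulr0.
  by rewrite vE/=; [ring|split; exact: set_mem].
have iG : (leb1 R).-integrable setT (EFin \o G).
  by have /integrable_mkcond := iB => /(_ mB); rewrite restrict_EFin.
have iF : (leb1 R).-integrable setT (EFin \o F).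
  have iA' : (leb1 R).-integrable A (EFin \o (fun x => C ^+ 2 * f x ^+ 2)).
    by have := integrableZl mA (C ^+ 2) iA; apply: eq_integrable.
  by have /integrable_mkcond := iA' => /(_ mA); rewrite restrict_EFin.
transitivity ((\int[leb1 R]_x F x) * (\int[leb1 R]_x G x)); last first.
  rewrite -Rintegral_mkcond -Rintegral_mkcond RintegralZl//.
rewrite /Rintegral -fineM; [|exact: integrable_fin_num..].
congr fine.
have mFG : measurable_fun setT (fun z : R * R => (F z.1 * G z.2)%:E).
  apply/measurable_EFinP; apply: measurable_funM.
    exact: measurableT_comp mF measurable_fst.
  exact: measurableT_comp mG measurable_snd.
rewrite fubini_tonelli1//; last by move=> z; rewrite lee_fin mulr_ge0.
rewrite /fubini_F /=.
transitivity (\int[leb1 R]_x ((F x)%:E * \int[leb1 R]_y (G y)%:E))%E.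
  apply: eq_integral => x _; rewrite -ge0_integralZl//.
  - by apply: measurableT_comp => //.
  - by move=> y _; rewrite lee_fin.
  - by rewrite lee_fin.
rewrite -(fineK (integrable_fin_num measurableT iG)).
rewrite ge0_integralZr//.
- exact/measurable_EFinP.
- by move=> x _; rewrite lee_fin.
- by rewrite lee_fin fine_ge0// integral_ge0// => y _; rewrite lee_fin.
Qed.

End Product.

(** * Asymptotics of the wave numbers and of the profile *)

Section Sequences.
Context {R : realType}.
Implicit Types (u v f g r : nat -> R).

Lemma cvg_near_eq u v (x : R) : (\forall k \near \oo, u k = v k) ->
  v @ \oo --> x -> u @ \oo --> x.
Proof.
move=> uv vx; apply: cvg_trans vx; apply: near_eq_cvg.
by apply: filterS uv => k ->.
Qed.

Lemma equiv_of_ratio f g r : (\forall k \near \oo, f k = g k * r k) ->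
  r @ \oo --> (1 : R) -> f ~_\oo g.
Proof.
move=> fgr r1; apply/eqaddoP => e e0.
have /cvgrPdist_le/(_ _ e0) := r1.
apply: filter_app; apply: filterS fgr => k fk re.
rewrite [X in `|X|](_ : _ = - ((1 - r k) * g k)); last by rewrite !fctE /= fk; ring.
by rewrite normrN normrM ler_wpM2r.
Qed.

End Sequences.

(** The contribution of the slab between [a] and [b], above the interface, to the
    squared norm of the profile equal to [sin (mu x)] below the interface. *)
Definition tail {R : realType} (H h0 mu kappa a b : R) :=
  (sin (mu * h0) / sinh (kappa * (H - h0))) ^+ 2 *
  \int[leb1 R]_(x in `]a, b[) (sinh (kappa * (H - x)) ^+ 2).

Section Asymptotics.
Context {R : realType}.
Variables (H h0 c1 : R) (l : nat) (lam M ka : nat -> R).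
Hypotheses (h0_gt0 : 0 < h0) (h0_ltH : h0 < H) (c1_gt1 : 1 < c1) (l_gt0 : (0 < l)%N).
Hypothesis M_gt0 : \forall k \near \oo, 0 < M k.
Hypothesis ka_gt0 : \forall k \near \oo, 0 < ka k.
Hypothesis lamE : \forall k \near \oo, lam k = M k ^+ 2 + (k%:R * pi) ^+ 2.
Hypothesis kaE : \forall k \near \oo, ka k ^+ 2 = (k%:R * pi) ^+ 2 - lam k / c1.
Hypothesis disp : \forall k \near \oo, dispersion H h0 (M k) (ka k) = 0.
Hypothesis M_branch : \forall k \near \oo, branch l.-1 (M k * h0).

Let B := l%:R * pi / h0.
Let L := H - h0.
Let c10 : 0 < c1. Proof. exact: lt_trans ltr01 c1_gt1. Qed.
Let L0 : 0 < L. Proof. by rewrite subr_gt0. Qed.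
Let p0 : 0 < pi :> R. Proof. exact: pi_gt0. Qed.
Let B0 : 0 < B. Proof. by rewrite divr_gt0// mulr_gt0// ltr0n. Qed.

Lemma M_ltB : \forall k \near \oo, M k < B.
Proof.
apply: filterS M_branch => k /andP[_].
by rewrite prednK// /B ltr_pdivlMr.
Qed.

Lemma kpi_cvgy : (k%:R * pi) ^+ 2 @[k --> \oo] --> (+oo : set_system R).
Proof.
apply/cvgryPge => A; near=> k.
have k1 : 1 <= k%:R :> R by near: k; exact: nbhs_infty_ger.
have kA : A <= k%:R by near: k; exact: nbhs_infty_ger.
have pi1 : 1 <= pi :> R by rewrite (le_trans _ (pi_ge2 R))// ler1n.
have kp : k%:R <= k%:R * pi :> R by rewrite ler_peMr// (le_trans _ k1).
rewrite (le_trans kA)// (le_trans kp)// expr2 ler_peMl//.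
  by rewrite mulr_ge0// ltW.
by rewrite (le_trans k1).
Unshelve. all: by end_near. Qed.

Lemma ka_cvgy : ka @ \oo --> +oo.
Proof.
apply/cvgryPge => A; near=> k.
have k0 : 0 < ka k by near: k.
have m0 : 0 < M k by near: k.
have mB : M k < B by near: k; exact: M_ltB.
have e : ka k ^+ 2 = (k%:R * pi) ^+ 2 - lam k / c1 by near: k.
have le : lam k = M k ^+ 2 + (k%:R * pi) ^+ 2 by near: k.
have big : (c1 * A ^+ 2 + B ^+ 2) / (c1 - 1) <= (k%:R * pi) ^+ 2.
  by near: k; move/cvgryPge : kpi_cvgy; apply.
rewrite leNgt; apply/negP => kA.
have : ka k ^+ 2 < A ^+ 2 by rewrite ltr_pXn2r// nnegrE ltW// (lt_trans k0).
have : M k ^+ 2 < B ^+ 2 by rewrite ltr_pXn2r// nnegrE ltW.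
have -> : ka k ^+ 2 = ((c1 - 1) * (k%:R * pi) ^+ 2 - M k ^+ 2) / c1.
  by rewrite e le; field; rewrite gt_eqF.
move: big; rewrite ler_pdivrMr ?subr_gt0// ltr_pdivrMr// => b1 b2 b3.
have : c1 * A ^+ 2 + B ^+ 2 - M k ^+ 2 < A ^+ 2 * c1.
  by apply: le_lt_trans b3; rewrite lerD2r [(c1 - 1) * _]mulrC.
by rewrite mulrC ltNge => /negP; apply; rewrite -addrA lerDl subr_ge0 ltW.
Unshelve. all: by end_near. Qed.

Lemma kaV_cvg0 : (ka k)^-1 @[k --> \oo] --> (0 : R).
Proof. exact: (gtr0_cvgV0 ka_gt0).2 ka_cvgy. Qed.

Lemma expR_ka_cvg0 d : 0 < d -> expR (- (d * ka k)) @[k --> \oo] --> (0 : R).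
Proof.
move=> d0; apply: (@squeeze_cvgr _ _ _ _ (fun=> 0) (fun k => d^-1 * (ka k)^-1)).
- near=> k; have k0 : 0 < ka k by near: k.
  rewrite expR_ge0/= expRN -invfM lef_pV2 ?posrE ?expR_gt0 ?mulr_gt0//.
  by rewrite (le_trans _ (expR_ge1Dx _))// lerDr.
- exact: cvg_cst.
- by rewrite -[X in _ --> X](mulr0 d^-1); apply: cvgMl_tmp; exact: kaV_cvg0.
Unshelve. all: by end_near. Qed.

Lemma ka_expR_cvg0 d : 0 < d -> ka k * expR (- (d * ka k)) @[k --> \oo] --> (0 : R).
Proof.
move=> d0.
apply: (@squeeze_cvgr _ _ _ _ (fun=> 0) (fun k => (d / 2) ^- 2 * (ka k)^-1)).
- near=> k; have k0 : 0 < ka k by near: k.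
  rewrite mulr_ge0 ?expR_ge0 ?(ltW k0)//=.
  have h : d / 2 * ka k <= expR (d / 2 * ka k).
    by rewrite (le_trans _ (expR_ge1Dx _))// lerDr.
  have dk : 0 < d / 2 * ka k by rewrite mulr_gt0// divr_gt0.
  have -> : expR (- (d * ka k)) = (expR (d / 2 * ka k))^-1 ^+ 2.
    by rewrite -expRN expr2 -expRD; congr expR; field.
  have hV : (expR (d / 2 * ka k))^-1 <= (d / 2 * ka k)^-1.
    by rewrite lef_pV2 ?posrE ?expR_gt0.
  rewrite (@le_trans _ _ (ka k * (d / 2 * ka k)^-1 ^+ 2))//.
    rewrite ler_pM2l// ler_pXn2r// ?nnegrE ?invr_ge0 ?expR_ge0// ltW//.
  by rewrite le_eqVlt; apply/orP; left; apply/eqP; field; rewrite !gt_eqF.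
- exact: cvg_cst.
- by rewrite -[X in _ --> X](mulr0 ((d / 2) ^- 2)); apply: cvgMl_tmp; exact: kaV_cvg0.
Unshelve. all: by end_near. Qed.

(** The form in which the dispersion relation shows the size [mu / kappa] of the
    amplitude at the interface. *)
Lemma sin_sqr_dispersion : \forall k \near \oo,
  (sin (M k * h0) / sinh (ka k * L)) ^+ 2 =
  M k ^+ 2 / ka k ^+ 2 * cos (M k * h0) ^+ 2 / cosh (ka k * L) ^+ 2.
Proof.
near=> k.
have k0 : 0 < ka k by near: k.
have m0 : 0 < M k by near: k.
have d : dispersion H h0 (M k) (ka k) = 0 by near: k.
have S0 : 0 < sinh (ka k * L) by rewrite sinh_gt0// mulr_gt0.
have C0 := cosh_gt0 (ka k * L).
have e : sin (M k * h0) = - (M k * cos (M k * h0) * sinh (ka k * L) / (ka k * cosh (ka k * L))).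
  apply/eqP; rewrite -subr_eq0 opprK; apply/eqP.
  transitivity (dispersion H h0 (M k) (ka k) / (ka k * cosh (ka k * L))).
    by rewrite /dispersion -/L; field; rewrite !gt_eqF.
  by rewrite d mul0r.
by rewrite e; field; rewrite !gt_eqF.
Unshelve. all: by end_near. Qed.

(** By the dispersion relation, [|sin (mu h0)| <= mu tanh (kappa L) / kappa]. *)
Lemma sin_M_cvg0 : sin (M k * h0) @[k --> \oo] --> (0 : R).
Proof.
apply/norm_cvg0P; apply: (@squeeze_cvgr _ _ _ _ (fun=> 0) (fun k => B * (ka k)^-1)).
- near=> k; rewrite normr_ge0/=.
  have k0 : 0 < ka k by near: k.
  have m0 : 0 < M k by near: k.
  have mB : M k < B by near: k; exact: M_ltB.
  have d : dispersion H h0 (M k) (ka k) = 0 by near: k.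
  have S0 : 0 < sinh (ka k * L) by rewrite sinh_gt0// mulr_gt0.
  have C0 := cosh_gt0 (ka k * L).
  have SC : sinh (ka k * L) <= cosh (ka k * L).
    rewrite sinhE coshE ler_pM2r// lerD2l (@le_trans _ _ 0) ?oppr_le0 ?expR_ge0//.
  rewrite -(ler_pM2r (mulr_gt0 k0 C0)) -{1}(gtr0_norm (mulr_gt0 k0 C0)) -normrM.
  have -> : sin (M k * h0) * (ka k * cosh (ka k * L)) = - (M k * sinh (ka k * L) * cos (M k * h0)).
    by apply/eqP; rewrite -subr_eq0 -d /dispersion -/L; apply/eqP; ring.
  rewrite normrN normrM ger0_norm; last by rewrite mulr_ge0// ltW.
  have -> : B / ka k * (ka k * cosh (ka k * L)) = B * cosh (ka k * L).
    by field; rewrite gt_eqF.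
  rewrite (@le_trans _ _ (M k * sinh (ka k * L)))//.
    by rewrite ler_piMr ?cos_max// mulr_ge0// ltW.
  by rewrite ler_pM// ltW.
- exact: cvg_cst.
- by rewrite -[X in _ --> X](mulr0 B); apply: cvgMl_tmp; exact: kaV_cvg0.
Unshelve. all: by end_near. Qed.

Lemma asin0 : asin (0 : R) = 0.
Proof.
by rewrite -{1}(sin0 R) sinK// in_itv/= oppr_le0 divr_ge0 ?pi_ge0.
Qed.

(** On the branch, [mu h0 - l pi] lies between [- pi / 2] and [0], so it is
    recovered from its sine. *)
Lemma M_cvg : M @ \oo --> B.
Proof.
pose e k := asin ((-1) ^+ l * sin (M k * h0)).
have ec : e @ \oo --> (0 : R).
  have h : (fun k => (-1) ^+ l * sin (M k * h0)) @ \oo --> (0 : R).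
    by rewrite -[X in _ --> X](mulr0 ((-1) ^+ l)); apply: cvgMl_tmp; exact: sin_M_cvg0.
  rewrite -asin0; apply: continuous_cvg h.
  by apply: continuous_asin; rewrite ltrN10 ltr01.
apply: (@cvg_near_eq _ _ (fun k => B + h0^-1 * e k)); last first.
  rewrite -[X in _ --> X]addr0 -[X in _ + X](mulr0 h0^-1).
  by apply: cvgD; [exact: cvg_cst|exact: cvgMl_tmp].
apply: filterS M_branch => k /andP[b1 b2].
rewrite /e.
have sE : sin (M k * h0) = (-1) ^+ l * sin (M k * h0 - l%:R * pi).
  by rewrite -sin_shift; congr sin; ring.
rewrite sE mulrA signr_sqr mul1r sinK.
  by rewrite /B; field; rewrite gt_eqF.
rewrite prednK// in b2.
have lE : l%:R * pi = l.-1%:R * pi + pi :> R by rewrite -natS_pi prednK.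
by rewrite in_itv/=; apply/andP; split; lra.
Unshelve. all: by end_near. Qed.

Lemma integral_sin_sqr mu a b : mu != 0 -> a <= b ->
  \int[leb1 R]_(x in `]a, b[) (sin (mu * x) ^+ 2) =
  (b - a) / 2 - (sin (2 * mu * b) - sin (2 * mu * a)) / (4 * mu).
Proof.
move=> mu0 ab.
have d : derives (fun x => x / 2 - sin (2 * mu * x) / (4 * mu))
                 (fun x => sin (mu * x) ^+ 2).
  apply: derives_eq; first by derive_rules.
  move=> x /=; rewrite (_ : 2 * mu * x = (mu * x) *+ 2); last by rewrite mulr2n; ring.
  by rewrite cos_mulr2n sin2cos2 mulr2n; field.
have c : continuous (fun x => sin (mu * x) ^+ 2) by continuity_rules.
by rewrite (integral_derive ab d c); field.
Qed.

Lemma integral_sinh_sqr kap a b : kap != 0 -> a <= b ->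
  \int[leb1 R]_(x in `]a, b[) (sinh (kap * (H - x)) ^+ 2) =
  (sinh (2 * (kap * (H - a))) - sinh (2 * (kap * (H - b)))) / (4 * kap) - (b - a) / 2.
Proof.
move=> k0 ab.
have d : derives (fun x => - (sinh (2 * (kap * (H - x))) / (4 * kap)) - x / 2)
                 (fun x => sinh (kap * (H - x)) ^+ 2).
  apply: derives_eq; first by derive_rules.
  move=> x /=; set y := kap * (H - x).
  have -> : 2 * y = y + y by ring.
  have yN : expR y != 0 by rewrite gt_eqF ?expR_gt0.
  by rewrite !sinhE !coshE opprD expRN !expRD expRN; field; rewrite k0 yN.
have c : continuous (fun x => sinh (kap * (H - x)) ^+ 2) by continuity_rules.
by rewrite (integral_derive ab d c); field.
Qed.

Lemma integral_sin_sqr_cvg a b : a <= b ->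
  \int[leb1 R]_(x in `]a, b[) (sin (M k * x) ^+ 2) @[k --> \oo] -->
  (b - a) / 2 - (sin (2 * B * b) - sin (2 * B * a)) / (4 * B).
Proof.
move=> ab.
apply: (@cvg_near_eq _ _ (fun k => (b - a) / 2 -
    (sin (2 * M k * b) - sin (2 * M k * a)) * (4 * M k)^-1)).
  by apply: filterS M_gt0 => k k0; rewrite integral_sin_sqr ?gt_eqF.
have sc x : (fun k => sin (2 * M k * x)) @ \oo --> sin (2 * B * x).
  have h : (fun k => 2 * M k * x) @ \oo --> 2 * B * x.
    by apply: cvgMr_tmp; apply: cvgMl_tmp; exact: M_cvg.
  by apply: continuous_cvg h; exact: continuous_sin.
apply: cvgB; first exact: cvg_cst.
apply: cvgM; first by apply: cvgB; exact: sc.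
apply: cvgV; first by rewrite mulf_neq0// gt_eqF.
by apply: cvgMl_tmp; exact: M_cvg.
Qed.

Lemma cos_sqr_M_cvg : cos (M k * h0) ^+ 2 @[k --> \oo] --> (1 : R).
Proof.
have -> : (fun k => cos (M k * h0) ^+ 2) = (fun k => 1 - sin (M k * h0) * sin (M k * h0)).
  by apply/funext => k; rewrite cos2sin2 expr2.
rewrite -[X in _ --> X]subr0 -[X in _ - X](mulr0 (0 : R)).
by apply: cvgB; [exact: cvg_cst|apply: cvgM; exact: sin_M_cvg0].
Qed.

(** With the closed form of the integral of [sinh^2], everything is a rational
    function of exponentials, and all of them but the leading one decay. *)
Lemma tail_cvg a b : h0 <= a -> a < b -> b <= H ->
  tail H h0 (M k) (ka k) a b * ka k ^+ 3 * expR (2 * (a - h0) * ka k) / M k ^+ 2 @[k --> \oo]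
    --> (1 / 2 : R).
Proof.
move=> ha ab bH.
pose E d k := expR (- (d * ka k)).
pose rhs k := cos (M k * h0) ^+ 2 *
  ((4 * ((1 + E (2 * L) k) * (1 + E (2 * L) k))^-1) *
   (1 / 8 * (1 - E (4 * (H - a)) k) -
    1 / 8 * (E (2 * (b - a)) k - E (2 * (H - a + (H - b))) k) -
    (b - a) / 2 * (ka k * E (2 * (H - a)) k))).
apply: (@cvg_near_eq _ _ rhs).
  near=> k.
  have k0 : 0 < ka k by near: k.
  have m0 : 0 < M k by near: k.
  rewrite /tail -/L (near sin_sqr_dispersion k)//.
  rewrite integral_sinh_sqr ?gt_eqF ?ltW// /rhs /E.
  pose p := expR (ka k * L); pose q := expR (ka k * (H - a)); pose w := expR (ka k * (H - b)).
  have P0 : p != 0 by rewrite gt_eqF// expR_gt0.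
  have Q0 : q != 0 by rewrite gt_eqF// expR_gt0.
  have W0 : w != 0 by rewrite gt_eqF// expR_gt0.
  have expR2 x : expR (2 * x) = expR x ^+ 2 by rewrite expr2 -expRD; congr expR; ring.
  have -> : expR (- (2 * L * ka k)) = p^-1 ^+ 2.
    by rewrite -expRN -expR2; congr expR; ring.
  have -> : expR (- (4 * (H - a) * ka k)) = (q^-1 ^+ 2) ^+ 2.
    by rewrite -expRN -!expR2; congr expR; ring.
  have -> : expR (- (2 * (b - a) * ka k)) = (w / q) ^+ 2.
    by rewrite -expRN -expRD -expR2; congr expR; ring.
  have -> : expR (- (2 * (H - a + (H - b)) * ka k)) = (w^-1 / q) ^+ 2.
    by rewrite -!expRN -expRD -expR2; congr expR; ring.
  have -> : expR (- (2 * (H - a) * ka k)) = q^-1 ^+ 2.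
    by rewrite -expRN -expR2; congr expR; ring.
  have -> : expR (2 * (a - h0) * ka k) = (p / q) ^+ 2.
    by rewrite -expRN -expRD -expR2; congr expR; rewrite /L; ring.
  have -> : cosh (ka k * L) = (p + p^-1) / 2 by rewrite coshE expRN.
  have -> : sinh (2 * (ka k * (H - a))) = (q ^+ 2 - (q ^+ 2)^-1) / 2.
    by rewrite sinhE expRN expR2.
  have -> : sinh (2 * (ka k * (H - b))) = (w ^+ 2 - (w ^+ 2)^-1) / 2.
    by rewrite sinhE expRN expR2.
  have p21 : p ^+ 2 + 1 != 0 by rewrite gt_eqF// ltr_wpDl// sqr_ge0.
  move: (cos _) p q w P0 Q0 W0 p21 => c p q w P0 Q0 W0 p21.
  by field; rewrite ?P0 ?Q0 ?W0 ?p21 ?gt_eqF.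
have Ec d : 0 < d -> E d @ \oo --> (0 : R) by exact: expR_ka_cvg0.
have -> : (1 / 2 : R) = 1 * ((4 * ((1 + 0) * (1 + 0))^-1) *
   (1 / 8 * (1 - 0) - 1 / 8 * (0 - 0) - (b - a) / 2 * 0)) by field.
apply: cvgM; first exact: cos_sqr_M_cvg.
have c1E : (fun k => 1 + E (2 * L) k) @ \oo --> (1 + 0 : R).
  by apply: cvgD; [exact: cvg_cst|apply: Ec; rewrite mulr_gt0].
apply: cvgM.
  apply: cvgMl_tmp; apply: cvgV; first by rewrite addr0 mulr1 oner_neq0.
  exact: cvgM.
apply: cvgB; last first.
  by apply: cvgMl_tmp; apply: ka_expR_cvg0; lra.
apply: cvgB.
  by apply: cvgMl_tmp; apply: cvgB; [exact: cvg_cst|apply: Ec; lra].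
by apply: cvgMl_tmp; apply: cvgB; apply: Ec; lra.
Unshelve. all: by end_near. Qed.

(** By [tail_cvg] the contribution of the upper layer is of order [kappa ^ -3]. *)
Lemma energy_cvg :
  \int[leb1 R]_(x in `]0, h0[) (sin (M k * x) ^+ 2) + tail H h0 (M k) (ka k) h0 H @[k --> \oo]
    --> h0 / 2.
Proof.
have -> : h0 / 2 = ((h0 - 0) / 2 - (sin (2 * B * h0) - sin (2 * B * 0)) / (4 * B)) +
    1 / 2 * (B * B * (0 * (0 * 0))).
  rewrite (_ : 2 * B * h0 = (2 * l)%:R * pi + 0); last first.
    by rewrite /B natrM; field; rewrite gt_eqF.
  by rewrite sin_shift mulr0 sin0; field; rewrite gt_eqF.
apply: cvgD; first by apply: integral_sin_sqr_cvg; exact: ltW.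
have T := tail_cvg (lexx h0) h0_ltH (lexx H).
have V := kaV_cvg0.
have T' := cvgM T (cvgM (cvgM M_cvg M_cvg) (cvgM V (cvgM V V))).
refine (cvg_near_eq _ (T' _ _ _ _ _)); near=> k.
have k0 : 0 < ka k by near: k.
have m0 : 0 < M k by near: k.
rewrite /= subrr mulr0 mul0r expR0.
by field; rewrite !gt_eqF.
Unshelve. all: by end_near. Qed.

Let s := Num.sqrt ((c1 - 1) / c1).
Let s0 : 0 < s. Proof. by rewrite sqrtr_gt0 divr_gt0// subr_gt0. Qed.
Let s2 : s ^+ 2 = (c1 - 1) / c1.
Proof. by rewrite sqr_sqrtr// divr_ge0 ?ltW// subr_gt0. Qed.

Lemma lam_gt0 : \forall k \near \oo, 0 < lam k.
Proof.
near=> k; rewrite (near lamE k)// ltr_wpDr ?sqr_ge0// exprn_gt0//.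
by near: k.
Unshelve. all: by end_near. Qed.

Lemma lamV_cvg0 : (lam k)^-1 @[k --> \oo] --> (0 : R).
Proof.
apply/(gtr0_cvgV0 lam_gt0)/cvgryPge => A.
have /cvgryPge/(_ A) := kpi_cvgy; apply: filter_app.
by apply: filterS lamE => k -> kA; rewrite (le_trans kA)// lerDr sqr_ge0.
Qed.

Lemma ka_sqr : \forall k \near \oo, ka k ^+ 2 = s ^+ 2 * lam k - M k ^+ 2.
Proof.
near=> k; rewrite (near kaE k)// s2.
have -> : (k%:R * pi) ^+ 2 = lam k - M k ^+ 2 by rewrite (near lamE k)//; ring.
by field; rewrite gt_eqF.
Unshelve. all: by end_near. Qed.

Lemma ka_ratio_cvg : ka k / Num.sqrt (lam k) @[k --> \oo] --> s.
Proof.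
apply: (@cvg_near_eq _ _ (fun k => Num.sqrt (s ^+ 2 - M k * M k * (lam k)^-1))).
  near=> k.
  have k0 : 0 < ka k by near: k.
  have l0 : 0 < lam k by near: k; exact: lam_gt0.
  have sl0 : 0 < Num.sqrt (lam k) by rewrite sqrtr_gt0.
  have e : ka k ^+ 2 = s ^+ 2 * lam k - M k ^+ 2 by near: k; exact: ka_sqr.
  rewrite -[LHS]ger0_norm ?divr_ge0 ?ltW// -sqrtr_sqr; congr Num.sqrt.
  by rewrite expr_div_n sqr_sqrtr ?ltW// e; field; rewrite gt_eqF.
have h : (fun k => s ^+ 2 - M k * M k * (lam k)^-1) @ \oo --> s ^+ 2 - B * B * 0.
  apply: cvgB; first exact: cvg_cst.
  by apply: cvgM; [apply: cvgM; exact: M_cvg|exact: lamV_cvg0].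
have e : s = Num.sqrt (s ^+ 2 - B * B * 0).
  by rewrite mulr0 subr0 sqrtr_sqr ger0_norm// ltW.
rewrite [X in _ --> X]e.
by apply: continuous_cvg h; exact: sqrt_continuous.
Unshelve. all: by end_near. Qed.

(** Indeed [kappa^2 - s^2 lambda = - mu^2] is bounded while [kappa] tends to
    infinity. *)
Lemma ka_diff_cvg : ka k - s * Num.sqrt (lam k) @[k --> \oo] --> (0 : R).
Proof.
apply/norm_cvg0P.
apply: (@squeeze_cvgr _ _ _ _ (fun=> 0) (fun k => B ^+ 2 * (ka k)^-1)).
- near=> k; rewrite normr_ge0/=.
  have k0 : 0 < ka k by near: k.
  have m0 : 0 < M k by near: k.
  have mB : M k < B by near: k; exact: M_ltB.
  have l0 : 0 < lam k by near: k; exact: lam_gt0.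
  have sl0 : 0 < s * Num.sqrt (lam k) by rewrite mulr_gt0// sqrtr_gt0.
  have e : ka k ^+ 2 = s ^+ 2 * lam k - M k ^+ 2 by near: k; exact: ka_sqr.
  rewrite -(ler_pM2r k0) mulfVK ?gt_eqF//.
  rewrite (@le_trans _ _ (`|ka k - s * Num.sqrt (lam k)| * (ka k + s * Num.sqrt (lam k))))//.
    by rewrite ler_wpM2l// lerDl ltW.
  rewrite -[X in _ * X <= _](ger0_norm (ltW (addr_gt0 k0 sl0))) -normrM.
  have -> : (ka k - s * Num.sqrt (lam k)) * (ka k + s * Num.sqrt (lam k)) = - M k ^+ 2.
    by rewrite -subr_sqr e exprMn [Num.sqrt (lam k) ^+ 2]sqr_sqrtr ?ltW//; ring.
  by rewrite normrN ger0_norm ?sqr_ge0// ler_pXn2r// ?nnegrE ltW.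
- exact: cvg_cst.
- by rewrite -[X in _ --> X](mulr0 (B ^+ 2)); apply: cvgMl_tmp; exact: kaV_cvg0.
Unshelve. all: by end_near. Qed.

End Asymptotics.

(** * Norms of the eigenfunctions *)

Section Norms.
Context {R : realType}.
Variables (H h0 c1 : R).
Hypotheses (h0_gt0 : 0 < h0) (h0_ltH : h0 < H) (c1_gt1 : 1 < c1).

Lemma mode_norms k (lambda mu kappa al : R) (u : R -> R) (v : R * R -> R) :
  (0 < k)%N -> 0 < mu -> 0 < kappa ->
  lambda = mu ^+ 2 + (k%:R * pi) ^+ 2 ->
  kappa ^+ 2 = (k%:R * pi) ^+ 2 - lambda / c1 ->
  transverse_mode H h0 c1 k lambda u -> al <> 0 ->
  (forall z, Omega H z -> v z = al * Num.sqrt 2 * sin (k%:R * pi * z.1) * u z.2) ->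
  exists C : R,
  [/\ C != 0,
      sqnorm (leb2 R) (Omega H) v = C ^+ 2 * (1 / 2 *
        (\int[leb1 R]_(x in `]0, h0[) (sin (mu * x) ^+ 2) +
         tail H h0 mu kappa h0 H)),
      forall (A : set (measurableTypeR R)) a b, measurable A -> A `<=` `]0, 1[ ->
        h0 <= a -> b <= H ->
        sqnorm (leb2 R) (A `*` `]a, b[) v =
        C ^+ 2 * (\int[leb1 R]_(x in A) (sin (k%:R * pi * x) ^+ 2)) *
        tail H h0 mu kappa a b &
      forall (A : set (measurableTypeR R)) a b, measurable A -> A `<=` `]0, 1[ ->
        0 <= a -> b <= h0 ->
        sqnorm (leb2 R) (A `*` `]a, b[) v =
        C ^+ 2 * (\int[leb1 R]_(x in A) (sin (k%:R * pi * x) ^+ 2)) *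
        \int[leb1 R]_(x in `]a, b[) (sin (mu * x) ^+ 2)].
Proof.
move=> k_gt0 mu0 ka0 lE kE tm al0 vE.
have [_ [be be0 [u0E u1E]]] := mode_explicit h0_gt0 h0_ltH mu0 ka0 lE kE tm.
have L0 : 0 < H - h0 by rewrite subr_gt0.
have SL0 : 0 < sinh (kappa * (H - h0)) by rewrite sinh_gt0// mulr_gt0.
pose ga := sin (mu * h0) / sinh (kappa * (H - h0)).
pose f (x : R) := sin (k%:R * pi * x).
pose g0 (x : R) := sin (mu * x).
pose g1 (x : R) := ga * sinh (kappa * (H - x)).
pose g (x : R) := if x < h0 then g0 x else g1 x.
have cf : continuous f by rewrite /f; continuity_rules.
have cg0 : continuous g0 by rewrite /g0; continuity_rules.
have cg1 : continuous g1 by rewrite /g1; continuity_rules.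
have cg : continuous g.
  by apply: continuous_glue => //; rewrite /g0 /g1 /ga mulfVK ?gt_eqF.
pose C := al * Num.sqrt 2 * be.
have C0 : C != 0.
  apply: mulf_neq0; last exact/eqP.
  apply: mulf_neq0; first exact/eqP.
  by rewrite gt_eqF// sqrtr_gt0.
have ug x : 0 < x -> x < H -> u x = be * g x.
  move=> x0 xH; rewrite /g; case: ltP => xh.
    by rewrite u0E// !ltW.
  by rewrite u1E ?xh ?ltW// /g1 /ga mulrA mulrA.
have cf2 : continuous (fun x => f x ^+ 2) by continuity_rules.
have cg2 : continuous (fun x => g x ^+ 2) by continuity_rules.
have prod (A : set (measurableTypeR R)) a b : measurable A -> A `<=` `]0, 1[ ->
    0 <= a -> b <= H ->
    sqnorm (leb2 R) (A `*` `]a, b[) v = C ^+ 2 *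
      (\int[leb1 R]_(x in A) (f x ^+ 2)) * \int[leb1 R]_(x in `]a, b[) (g x ^+ 2).
  move=> mA A01 a0 bH; apply: sqnorm_product => //.
  - exact: (integrable_sub mA A01 cf2).
  - exact: integrable_itvoo.
  move=> [x y] [/= xA]; rewrite in_itv/= => /andP[ay yb].
  have y0 := le_lt_trans a0 ay; have yH := lt_le_trans yb bH.
  rewrite vE/=; first by rewrite ug// /C /f; ring.
  by split => /=; [exact: A01|rewrite in_itv/= y0 yH].
have tail_g1 a b : \int[leb1 R]_(x in `]a, b[) (g1 x ^+ 2) = tail H h0 mu kappa a b.
  rewrite /tail -/ga -integralZf; last by continuity_rules.
  by apply: eq_Rintegral => x _; rewrite exprMn.
exists C; split => //.
- rewrite /Omega prod// ?ltW ?(lt_trans h0_gt0)//.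
  rewrite integral_sin_sqr_unit// -mulrA; congr (_ * (_ * _)).
  rewrite -tail_g1 -integral_piecewise ?ltW//; [|by continuity_rules..].
  by apply: eq_Rintegral => x _; rewrite /g; case: ifP.
- move=> A a b mA A01 ha bH; rewrite prod//; last by rewrite (le_trans _ ha)// ltW.
  congr (_ * _); rewrite -tail_g1; apply: eq_Rintegral => x.
  by rewrite inE/= in_itv/= => /andP[ax _]; rewrite /g ltNge (le_trans ha (ltW ax)).
- move=> A a b mA A01 a0 bh; rewrite prod//; last by rewrite (le_trans bh)// ltW.
  congr (_ * _); apply: eq_Rintegral => x.
  by rewrite inE/= in_itv/= => /andP[_ xb]; rewrite /g (lt_le_trans xb bh).
Qed.

End Norms.

Section Auxiliary.
Context {R : realType}.

(** Shows that the limit in the lower layer is not zero. *)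
Lemma norm_sin_lt (y : R) : 0 < y -> `|sin y| < y.
Proof.
move=> y0; have [piy|ypi] := leP pi y.
  rewrite (le_lt_trans (sin_max y))// (lt_le_trans _ piy)//.
  by rewrite (lt_le_trans _ (pi_ge2 R))// ltr1n.
have d : derives (fun x : R => sin x) (fun x => cos x * 1).
  exact: derives_sin derives_id.
have cw : {within `[0, y], continuous (fun x : R => sin x)}.
  exact: continuous_subspaceT (is_derive_continuous d).
have [c] := MVT y0 (fun x _ => d x) cw.
rewrite in_itv/= => /andP[c0 cy]; rewrite sin0 !subr0 mulr1 => ->.
rewrite normrM (gtr0_norm y0) gtr_pMl// lt_neqAle cos_max andbT norm_cos_eq1.
by rewrite gt_eqF// sin_gt0_pi// c0 (lt_trans cy).
Qed.

Lemma subset_itvoo (a b c d : R) : a < b -> `]a, b[ `<=` `]c, d[ -> c <= a /\ b <= d.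
Proof.
move=> ab sub; split.
  rewrite leNgt; apply/negP => ac.
  have : `]a, b[%classic ((a + Num.min b c) / 2).
    rewrite /= in_itv/=; have mb : Num.min b c <= b by rewrite ge_min lexx.
    have ma : a < Num.min b c by rewrite lt_min ab ac.
    by apply/andP; split; lra.
  move=> /sub; rewrite /= in_itv/= => /andP[+ _].
  have mc : Num.min b c <= c by rewrite ge_min lexx orbT.
  lra.
rewrite leNgt; apply/negP => db.
have : `]a, b[%classic ((b + Num.max a d) / 2).
  rewrite /= in_itv/=; have mb : a <= Num.max a d by rewrite le_max lexx.
  have ma : Num.max a d < b by rewrite gt_max ab db.
  by apply/andP; split; lra.
move=> /sub; rewrite /= in_itv/= => /andP[_].
have mc : d <= Num.max a d by rewrite le_max lexx orbT.
lra.
Qed.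

Lemma powR_three_halves (x : R) : 0 <= x -> x `^ (3 / 2) = Num.sqrt x ^+ 3.
Proof.
by move=> x0; rewrite mulrC powRrM powR12_sqrt// powR_mulrn// sqrtr_ge0.
Qed.

Lemma powR_half (x : R) : 0 <= x -> x `^ (1 / 2) = Num.sqrt x.
Proof. by move=> x0; rewrite mul1r powR12_sqrt. Qed.

Lemma leb1_itvoo (a b : R) : a <= b -> leb1 R [set` `]a, b[] = (b - a)%:E.
Proof.
rewrite le_eqVlt => /predU1P[->|ab].
  by rewrite set_itvoo0 ?ltxx// measure0 subrr.
by rewrite /leb1 /= lebesgue_measure_itv/= lte_fin ab EFinB.
Qed.

Lemma leb1_open_gt0 (A : set R) : open A -> A !=set0 -> (0 < leb1 R A)%E.
Proof.
move=> oA [x Ax].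
have /nbhs_ballP[e /= e0 eA] : nbhs x A by exact: open_nbhs_nbhs.
apply: (@lt_le_trans _ _ (leb1 R [set` `]x - e, x + e[])).
  by rewrite leb1_itvoo ?lte_fin; lra.
apply: le_measure; rewrite ?inE//; first exact: open_measurable.
move=> y; rewrite /= in_itv/= => /andP[y1 y2]; apply: eA.
by rewrite /ball/= ltr_norml; apply/andP; split; lra.
Qed.

Lemma leb1_unit_fin (A : set R) : measurable A -> A `<=` `]0, 1[ ->
  leb1 R A \is a fin_num.
Proof.
move=> mA A01; rewrite ge0_fin_numE//.
apply: (@le_lt_trans _ _ (leb1 R [set` `]0, 1[])); last by rewrite leb1_itvoo// ltry.
by apply: le_measure; rewrite ?inE.
Qed.

End Auxiliary.

(** * Asymptotics of the eigenfunctions *)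

Theorem mainTheorem5 (R : realType) (H h0 c1 : R)
    (H_gt0 : 0 < H) (h0_gt0 : 0 < h0) (h0_ltH : h0 < H) (c1_gt1 : 1 < c1)
    (lam : nat -> nat -> R) (lamP : transverse_spectrum H h0 c1 lam)
    (l : nat) (l_gt0 : (0 < l)%N)
    (v : nat -> R * R -> R)
    (vP : \forall k \near \oo,
       separated_eigenfunction H h0 c1 lam k l (v k) /\ guided c1 lam k l)
    (omega1 : set R) (omega1_open : open omega1) (omega1_neq0 : omega1 !=set0)
    (omega1_sub : omega1 `<=` `]0, 1[)
    (a b : R) (a_ltb : a < b)
    (omega_sub : omega1 `*` `]a, b[ `<=` Omega H) :
  let omega : set (R * R) := (omega1 `*` `]a, b[) in
  let a1 := fine (leb1 R omega1) * (l%:R * pi) ^+ 2 / h0 ^+ 3 *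
            (c1 / (c1 - 1)) `^ (3 / 2) in
  let a2 := 2 * (a - h0) * Num.sqrt ((c1 - 1) / c1) in
  let theta := l%:R * (pi / h0) in
  (omega `<=` Omega1 H h0 ->
     (fun k : nat => a1 * lam k l `^ (- (3 / 2)) *
        expR (- a2 * lam k l `^ (1 / 2)) * sqnorm (leb2 R) (Omega H) (v k))
     ~_\oo (fun k : nat => sqnorm (leb2 R) omega (v k)))
  /\
  (omega `<=` Omega0 h0 ->
     (fun k : nat => sqnorm (leb2 R) omega (v k) /
                     sqnorm (leb2 R) (Omega H) (v k))
     ~_\oo (fun=> 1 / h0 * fine (leb2 R omega) *
        (1 - sin (theta * (b - a)) / (theta * (b - a)) *
             cos (theta * (a + b))))).
Proof.
move=> omega a1 a2 theta.
have c10 : 0 < c1 by exact: lt_trans ltr01 c1_gt1.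
have p0 : 0 < pi :> R := pi_gt0 R.
pose M (k : nat) : R := Num.sqrt (lam k l - (k%:R * pi) ^+ 2).
pose ka (k : nat) : R := Num.sqrt ((k%:R * pi) ^+ 2 - lam k l / c1).
have mA : measurable (omega1 : set (measurableTypeR R)).
  exact: open_measurable.
have params : \forall k \near \oo, [/\ 0 < M k, 0 < ka k,
    lam k l = M k ^+ 2 + (k%:R * pi) ^+ 2 &
    ka k ^+ 2 = (k%:R * pi) ^+ 2 - lam k l / c1].
  by apply: filterS vP => k [_ gd]; exact: guided_parameters.
have M_gt0 : \forall k \near \oo, 0 < M k by apply: filterS params => k [].
have ka_gt0 : \forall k \near \oo, 0 < ka k by apply: filterS params => k [].
have lamE : \forall k \near \oo, lam k l = M k ^+ 2 + (k%:R * pi) ^+ 2.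
  by apply: filterS params => k [].
have kaE : \forall k \near \oo, ka k ^+ 2 = (k%:R * pi) ^+ 2 - lam k l / c1.
  by apply: filterS params => k [].
have k_gt0 : \forall k \near \oo, (0 < k)%N by exact: nbhs_infty_gt.
have disp : \forall k \near \oo, dispersion H h0 (M k) (ka k) = 0.
  apply: filterS2 vP params => k [[_ [a' [u [_ tm _]]]] _] [Mk kk lk kEk].
  by have [] := mode_explicit h0_gt0 h0_ltH Mk kk lk kEk tm.
have M_branch : \forall k \near \oo, branch l.-1 (M k * h0).
  apply: filterS3 vP params k_gt0 => k [_ /andP[_ lK]] [Mk kk lk kEk] k0.
  exact: (spectrum_branch h0_gt0 h0_ltH c1_gt1 lamP k0 l_gt0 lK Mk kk lk kEk).
pose S k := \int[leb1 R]_(x in omega1) (sin (k%:R * pi * x) ^+ 2).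
pose I k := \int[leb1 R]_(x in `]a, b[) (sin (M k * x) ^+ 2).
pose N k := \int[leb1 R]_(x in `]0, h0[) (sin (M k * x) ^+ 2) +
            tail H h0 (M k) (ka k) h0 H.
have norms : \forall k \near \oo, exists C : R,
  [/\ C != 0,
      sqnorm (leb2 R) (Omega H) (v k) = C ^+ 2 * (1 / 2 * N k),
      h0 <= a -> b <= H -> sqnorm (leb2 R) omega (v k) =
        C ^+ 2 * S k * tail H h0 (M k) (ka k) a b &
      0 <= a -> b <= h0 -> sqnorm (leb2 R) omega (v k) = C ^+ 2 * S k * I k].
  apply: filterS3 vP params k_gt0.
  move=> k [[_ [a' [u [a'0 tm vE]]]] _] [Mk kk lk kEk] k0.
  have [C [C0 nO n1 n2]] :=
    mode_norms h0_gt0 h0_ltH k0 Mk kk lk kEk tm a'0 vE.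
  exists C; split => //.
  - by move=> ha bH; exact: n1.
  - by move=> ha bH; exact: n2.
pose B := l%:R * pi / h0.
have B0 : 0 < B by rewrite divr_gt0// mulr_gt0// ltr0n.
pose V := fine (leb1 R omega1).
have Vfin := leb1_unit_fin mA omega1_sub.
have V0 : 0 < V.
  by rewrite fine_gt0// leb1_open_gt0//= -ge0_fin_numE.
have S_cvg : S @ \oo --> V / 2 by exact: cvg_sin_sqr_integral.
have N_cvg : N @ \oo --> h0 / 2.
  exact: (energy_cvg h0_gt0 h0_ltH c1_gt1 l_gt0 M_gt0 ka_gt0 lamE kaE disp M_branch).
have lam_gt : \forall k \near \oo, 0 < lam k l.
  exact: (lam_gt0 M_gt0 lamE).
have S_gt0 : \forall k \near \oo, 0 < S k.
  by apply: (cvgr_gt _ S_cvg); rewrite divr_gt0.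
have N_gt0 : \forall k \near \oo, 0 < N k.
  by apply: (cvgr_gt _ N_cvg); rewrite divr_gt0.
have sub_itv (J : set R) : omega `<=` `]0, 1[ `*` J -> `]a, b[ `<=` J.
  have [x ox] := omega1_neq0.
  by move=> sub y aby; have [] := sub (x, y) (conj ox aby).
have [a_ge0 b_leH] := subset_itvoo a_ltb (sub_itv _ omega_sub).
pose s : R := Num.sqrt ((c1 - 1) / c1).
have s0 : 0 < s by rewrite sqrtr_gt0 divr_gt0// subr_gt0.
split=> [in1|in0].
  have [ha _] := subset_itvoo a_ltb (sub_itv _ in1).
  pose T k := tail H h0 (M k) (ka k) a b * ka k ^+ 3 * expR (2 * (a - h0) * ka k) / M k ^+ 2.
  have T_cvg : T @ \oo --> (1 / 2 : R).
    exact: (tail_cvg h0_gt0 h0_ltH c1_gt1 l_gt0 M_gt0 ka_gt0 lamE kaE disp M_branch).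
  have T_gt0 : \forall k \near \oo, 0 < T k.
    by apply: (cvgr_gt _ T_cvg); rewrite divr_gt0.
  pose r (k : nat) : R := a1 * (1 / 2 * N k) *
    ((ka k / Num.sqrt (lam k l)) * ((ka k / Num.sqrt (lam k l)) * (ka k / Num.sqrt (lam k l)))) *
    expR (2 * (a - h0) * (ka k - s * Num.sqrt (lam k l))) *
    (S k * T k * (M k * M k))^-1.
  (* The factor [exp (- a2 sqrt lambda)] is split so that only the difference
     [ka k - s * sqrt lambda], which tends to 0, is left in the ratio. *)
  apply: (@equiv_of_ratio _ _ _ r).
    move: norms; apply: filter_app; near=> k => -[C [C0 nO n1 _]].
    have k0 : 0 < ka k by near: k.
    have M0 : 0 < M k by near: k.
    have l0 : 0 < lam k l by near: k.
    have Sk0 : 0 < S k by near: k.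
    have Tk0 : 0 < T k by near: k.
    have sl0 : 0 < Num.sqrt (lam k l) by rewrite sqrtr_gt0.
    rewrite nO (n1 ha b_leH) powRN powR_three_halves ?ltW// powR_half ?ltW//.
    have e1 : expR (- a2 * Num.sqrt (lam k l)) =
      expR (2 * (a - h0) * (ka k - s * Num.sqrt (lam k l))) / expR (2 * (a - h0) * ka k).
      by rewrite -expRN -expRD /a2 -/s; congr expR; ring.
    have e2 : tail H h0 (M k) (ka k) a b =
      T k * M k ^+ 2 / (ka k ^+ 3 * expR (2 * (a - h0) * ka k)).
      by rewrite /T; field; rewrite !gt_eqF ?expR_gt0.
    rewrite e1 e2 /r; have E0 := expR_gt0 (2 * (a - h0) * ka k).
    by field; rewrite !gt_eqF.
  have ratio := ka_ratio_cvg h0_gt0 h0_ltH c1_gt1 l_gt0 M_gt0 ka_gt0 lamE kaE disp M_branch.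
  have diff := ka_diff_cvg h0_gt0 c1_gt1 l_gt0 M_gt0 ka_gt0 lamE kaE M_branch.
  have MB := M_cvg h0_gt0 h0_ltH c1_gt1 l_gt0 M_gt0 ka_gt0 lamE kaE disp M_branch.
  have a1E : a1 = V * (l%:R * pi) ^+ 2 / h0 ^+ 3 * (s ^+ 3)^-1.
    rewrite /a1 powR_three_halves ?divr_ge0 ?ltW ?subr_gt0//.
    by rewrite -[c1 / (c1 - 1)]invrK invf_div sqrtrV -?/s ?exprVn// divr_ge0 ?ltW ?subr_gt0.
  have -> : (1 : R) = a1 * (1 / 2 * (h0 / 2)) * (s * (s * s)) *
      expR (2 * (a - h0) * 0) * (V / 2 * (1 / 2) * (B * B))^-1.
    have w0 : 0 < l%:R * pi :> R by rewrite mulr_gt0// ltr0n.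
    rewrite mulr0 expR0 a1E /B; move: (l%:R * pi) w0 => w w0; field.
    by rewrite !gt_eqF.
  apply: cvgM; last first.
    apply: cvgV; first by rewrite !mulf_neq0 ?invr_eq0 ?oner_eq0 ?pnatr_eq0// gt_eqF.
    by apply: cvgM; apply: cvgM.
  apply: cvgM; last first.
    apply: (continuous_cvg _ (h := expR)); first exact: continuous_expR.
    exact: cvgMl_tmp.
  apply: cvgM; last by apply: cvgM => //; exact: cvgM.
  by apply: cvgMl_tmp; exact: cvgMl_tmp.
have [_ bh] := subset_itvoo a_ltb (sub_itv _ in0).
have thE : theta = B by rewrite /theta /B mulrA.
pose Q := 1 / h0 * fine (leb2 R omega) *
        (1 - sin (theta * (b - a)) / (theta * (b - a)) * cos (theta * (a + b))).
have ba0 : 0 < B * (b - a) by rewrite mulr_gt0// subr_gt0.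
have leb2E : fine (leb2 R omega) = V * (b - a).
  rewrite /leb2 /omega /= product_measure1E// -/(leb1 R) fineM//.
    by rewrite leb1_itvoo// ltW.
  by rewrite leb1_itvoo// ltW.
have Q0 : Q != 0.
  rewrite /Q leb2E thE gt_eqF// mulr_gt0//.
    by rewrite mulr_gt0 ?divr_gt0// mulr_gt0// subr_gt0.
  rewrite subr_gt0 (le_lt_trans (ler_norm _))// normrM.
  rewrite (@le_lt_trans _ _ `|sin (B * (b - a)) / (B * (b - a))|)//.
    by rewrite ler_piMr// cos_max.
  rewrite normrM normfV (gtr0_norm ba0) ltr_pdivrMr// mul1r.
  exact: norm_sin_lt.
have I_cvg := integral_sin_sqr_cvg h0_gt0 h0_ltH c1_gt1 l_gt0 M_gt0 ka_gt0 lamE kaE disp M_branch (ltW a_ltb).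
apply: (@equiv_of_ratio _ _ _ (fun k => Q^-1 * (S k * I k * (1 / 2 * N k)^-1))).
  move: norms; apply: filter_app; near=> k => -[C [C0 nO _ n2]].
  have Nk0 : 0 < N k by near: k.
  rewrite nO (n2 a_ge0 bh) -/Q.
  by field; rewrite Q0 C0 gt_eqF.
have limE : (1 : R) = Q^-1 * ((V / 2) *
   ((b - a) / 2 - (sin (2 * B * b) - sin (2 * B * a)) / (4 * B)) *
   (1 / 2 * (h0 / 2))^-1).
  have QE : Q = (V / 2) *
   ((b - a) / 2 - (sin (2 * B * b) - sin (2 * B * a)) / (4 * B)) *
   (1 / 2 * (h0 / 2))^-1.
    rewrite /Q leb2E thE.
    have -> : 2 * B * b = B * (a + b) + B * (b - a) by ring.
    have -> : 2 * B * a = B * (a + b) - B * (b - a) by ring.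
    rewrite sinD sinB; field.
    by rewrite !gt_eqF// subr_gt0.
  by rewrite -QE mulVf.
rewrite [X in _ --> X]limE.
apply: cvgMl_tmp; apply: cvgM; first exact: cvgM.
apply: cvgV; first by rewrite !mulf_neq0 ?invr_eq0 ?oner_eq0 ?pnatr_eq0// gt_eqF.
exact: cvgMl_tmp.
Unshelve. all: by end_near. Qed.
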